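(* Let $n$ be a positive integer, let $m,t$ be positive divisors of $n$ with $n\nmid mt$, let $\zeta\in\Bbbk$ be a primitive $n$-th root of unity, and let $H=H_n(\zeta,m,t)$. Suppose $H$-module algebra structures $A(H)$ exist and fix one, $A=A(H)$. If $m\neq n/2$ (e.g. if $n$ is odd), then there are precisely $t$ ways to extend the action of $H$ to make $A$ a $D(H)$-module algebra. In particular, if $t=1$ (and $m\ne n/2$), then the desired $H$-module algebra structure $A(H)$ exists, and the way to extend the action to $D(H)$ is unique. If $m=n/2$, then in order to extend the action of $H$ on $A$ to an action of $D(H)$ making $A$ a $D(H)$-module algebra, there are $t$ ways to define the action of the generator $Y$, and the choice for the action of $X$ is parametrized by $\Bbbk$.
   Context: $\Bbbk$ is an algebraically closed field of characteristic $0$. For grouplike elements $g,h$, an element $c$ is $(g,h)$-skew primitive if $\Delta(c)=g\otimes c+c\otimes h$. $H_n(\zeta,m,t)$ is the Hopf algebra generated as a $\Bbbk$-algebra by $y,x$ subject to $y^n=1$, $x^N=0$ (where $N=\operatorname{ord}(\zeta^{mt})$) and $yx=\zeta^t xy$, with $y$ grouplike and $x$ being $(y^m,1)$-skew primitive. An $H$-module algebra is an algebra $A$ that is a left $H$-module with $h\cdot(ab)=(h_{(1)}\cdot a)(h_{(2)}\cdot b)$ and $h\cdot 1_A=\epsilon(h)1_A$. The action is inner-faithful if $I\cdot A\neq 0$ for every nonzero Hopf ideal $I$ of $H$. $A(H)$ denotes an inner-faithful $H$-module algebra which, as an algebra, is $\Bbbk[u]/(u^n-1)$ (isomorphic to the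 group algebra of the grouplikes $\langle y\rangle$), where $u$ can be chosen with $y\cdot u=\zeta u$. The Drinfel'd double $D(H)$ of $H=H_n(\zeta,m,t)$ is the Hopf algebra generated by grouplike elements $y,Y$, a $(y^m,1)$-skew primitive element $x$, and a $(1,Y^t)$-skew primitive element $X$, subject to $$y^n=Y^n=1,\quad x^N=X^N=0,\quad yx=\zeta^t xy,\quad YX=\zeta^m XY,$$ $$yY=Yy,\quad xY=\zeta^m Yx,\quad yX=\zeta^{-t}Xy,\quad xX-Xx=Y^t-y^m;$$ it contains $H$ as the Hopf subalgebra generated by $x,y$. An extension of the $H$-action is an action of $D(H)$ making $A$ a $D(H)$-module algebra and restricting to the given action of $H$. *)

(* Defs.v *)
From HB Require Import structures.
From mathcomp Require Import all_boot all_order all_algebra.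
From mathcomp Require Import boolp classical_sets functions cardinality.

Set Implicit Arguments.
Unset Strict Implicit.
Unset Printing Implicit Defensive.

Import GRing.Theory.
Local Open Scope ring_scope.

(* A list [:: (v1, w1); ...; (vr, wr)] stands for the tensor
   \sum_i v_i (x) w_i. Two lists denote the same element of V (x) W iff no
   bilinear map separates them. *)
Definition tensor_eq (k : fieldType) (V W : lmodType k) (s1 s2 : seq (V * W)) :
    Prop :=
  forall (U : lmodType k) (f : V -> W -> U), bilinear_for *:%R *:%R f ->
    \sum_(p <- s1) f p.1 p.2 = \sum_(p <- s2) f p.1 p.2.

Definition trilinear (k : fieldType) (V1 V2 V3 U : lmodType k)
    (f : V1 -> V2 -> V3 -> U) : Prop :=
  [/\ forall b c, linear (fun a => f a b c),
      forall a c, linear (fun b => f a b c) &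
      forall a b, linear (fun c => f a b c)].

(* [comul h] is a list of pairs (h_(1), h_(2)) as in Sweedler's notation; it
   matters only up to [tensor_eq]. *)
Record hopfAlgebra (k : fieldType) := HopfAlgebra {
  hopf_carrier :> algType k;
  comul : hopf_carrier -> seq (hopf_carrier * hopf_carrier);
  counit : {lrmorphism hopf_carrier -> k^o};
  antipode : {linear hopf_carrier -> hopf_carrier};
  comul_linear : forall (c : k) (g h : hopf_carrier),
    tensor_eq (comul (c *: g + h))
      ([seq (c *: p.1, p.2) | p <- comul g] ++ comul h);
  comul1 : tensor_eq (comul 1) [:: (1, 1)];
  comulM : forall g h : hopf_carrier,
    tensor_eq (comul (g * h))
      [seq (p.1 * q.1, p.2 * q.2) | p <- comul g, q <- comul h];
  comulA : forall (U : lmodType k)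
      (f : hopf_carrier -> hopf_carrier -> hopf_carrier -> U),
    trilinear f -> forall h : hopf_carrier,
    \sum_(p <- comul h) \sum_(q <- comul p.1) f q.1 q.2 p.2 =
    \sum_(p <- comul h) \sum_(q <- comul p.2) f p.1 q.1 q.2;
  counit_comul_l : forall h : hopf_carrier,
    \sum_(p <- comul h) (counit p.1 : k) *: p.2 = h;
  counit_comul_r : forall h : hopf_carrier,
    \sum_(p <- comul h) (counit p.2 : k) *: p.1 = h;
  antipode_comul_l : forall h : hopf_carrier,
    \sum_(p <- comul h) antipode p.1 * p.2 = (counit h : k)%:A;
  antipode_comul_r : forall h : hopf_carrier,
    \sum_(p <- comul h) p.1 * antipode p.2 = (counit h : k)%:A
}.

Arguments comul {k _} _ : rename.
Arguments counit {k _} : rename.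
Arguments antipode {k _} : rename.

Definition grouplike (k : fieldType) (H : hopfAlgebra k) (g : H) : Prop :=
  g != 0 /\ tensor_eq (comul g) [:: (g, g)].

Definition skew_primitive (k : fieldType) (H : hopfAlgebra k) (g h c : H) :
    Prop :=
  tensor_eq (comul c) [:: (g, c); (c, h)].

(* The coideal condition says Delta(I) \subset I (x) H + H (x) I. *)
Definition hopf_ideal (k : fieldType) (H : hopfAlgebra k) (I : {pred H}) :
    Prop :=
  [/\ submod_closed I,
      forall g h : H, h \in I -> (g * h \in I) /\ (h * g \in I),
      forall h : H, h \in I -> exists2 s : seq (H * H),
        tensor_eq (comul h) s &
        forall p, p \in s -> (p.1 \in I) \/ (p.2 \in I),
      forall h : H, h \in I -> counit h = 0 &
      forall h : H, h \in I -> antipode h \in I].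

(* [H] is the k-algebra generated by the entries of [gs] subject to the
   relations [rel]. *)
Definition presented_by (k : fieldType)
    (rel : forall B : algType k, seq B -> Prop) (H : algType k) (gs : seq H) :
    Prop :=
  [/\ rel H gs,
      forall S : {pred H}, subalg_closed S -> {subset gs <= S} ->
        forall h, h \in S &
      forall (B : algType k) (gs' : seq B), rel B gs' ->
        exists phi : {lrmorphism H -> B}, map phi gs = gs'].

Definition Hn_rel (k : fieldType) (n t N : nat) (zeta : k) (B : algType k)
    (gs : seq B) : Prop :=
  if gs is [:: y; x] then
    [/\ y ^+ n = 1, x ^+ N = 0 & y * x = zeta ^+ t *: (x * y)]
  else False.

Definition is_Hn (k : fieldType) (n m t N : nat) (zeta : k)
    (H : hopfAlgebra k) (y x : H) : Prop :=
  [/\ presented_by (@Hn_rel k n t N zeta) [:: y; x],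
      grouplike y & skew_primitive (y ^+ m) 1 x].

Definition double_rel (k : fieldType) (n m t N : nat) (zeta : k)
    (B : algType k) (gs : seq B) : Prop :=
  if gs is [:: y; Y; x; X] then
    [/\ y ^+ n = 1 /\ Y ^+ n = 1,
        x ^+ N = 0 /\ X ^+ N = 0,
        y * x = zeta ^+ t *: (x * y) /\ Y * X = zeta ^+ m *: (X * Y),
        [/\ y * Y = Y * y, x * Y = zeta ^+ m *: (Y * x) &
            y * X = zeta ^- t *: (X * y)] &
        x * X - X * x = Y ^+ t - y ^+ m]
  else False.

Definition is_double_Hn (k : fieldType) (n m t N : nat) (zeta : k)
    (D : hopfAlgebra k) (y Y x X : D) : Prop :=
  [/\ presented_by (@double_rel k n m t N zeta) [:: y; Y; x; X],
      grouplike y, grouplike Y,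
      skew_primitive (y ^+ m) 1 x & skew_primitive 1 (Y ^+ t) X].

Definition module_algebra (k : fieldType) (H : hopfAlgebra k) (A : algType k)
    (act : H -> A -> A) : Prop :=
  [/\ bilinear_for *:%R *:%R act,
      forall a, act 1 a = a,
      forall g h a, act (g * h) a = act g (act h a),
      forall h a b, act h (a * b) =
        \sum_(p <- comul h) act p.1 a * act p.2 b &
      forall h, act h 1 = (counit h : k)%:A].

Definition inner_faithful (k : fieldType) (H : hopfAlgebra k) (A : algType k)
    (act : H -> A -> A) : Prop :=
  forall I : {pred H}, hopf_ideal I -> (exists2 h, h \in I & h != 0) ->
    exists2 h, h \in I & exists a, act h a != 0.

(* The isomorphism phi presents A as k[u]/(u^n - 1), with u := phi 'qX. *)
Definition is_AH (k : fieldType) (n : nat) (zeta : k) (H : hopfAlgebra k)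
    (y : H) (A : algType k) (act : H -> A -> A) : Prop :=
  [/\ module_algebra act, inner_faithful act &
      exists phi : {lrmorphism {poly %/ ('X^n - 1 : {poly k})} -> A},
        bijective phi /\ act y (phi 'qX) = zeta *: phi 'qX].

Definition extensions (k : fieldType) (H D : hopfAlgebra k) (iota : H -> D)
    (A : algType k) (act : H -> A -> A) : set (D -> A -> A) :=
  [set actD | module_algebra actD /\ forall h a, actD (iota h) a = act h a]%classic.

(* Main.v *)
(* Fix u in A with y.u = zeta u and put q = zeta^m. Since the weights of y on A
   are distinct, x.u^i = c (q^i - 1) u^(i+t) for a scalar c, and c != 0 because
   the ideal generated by x is a nonzero Hopf ideal. The relation x^N = 0 then
   forces q^(1+jt) = 1 for some j, hence t divides m. In an extension, Y and X
   are again determined by weights: Y.u^i = lam^i u^i and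
   X.u^i = d (q^-i - 1) u^(i-t); the relation xY = zeta^m Yx says
   lam^t = q^-1, which has t solutions, and xX - Xx = Y^t - y^m says
   (q^i - q^-i) (c d (q^-t - 1) - 1) = 0 for all i. The latter fixes d unless
   q^2 = 1, i.e. 2m = n, in which case d is free. Conversely these formulas
   satisfy all relations. Indices of u are kept natural by writing n - t for -t.

   For the existence of A(H), a Hopf ideal killing A kills A (x) A, and H acts
   faithfully on the latter. *)
Require Import Defs.
From HB Require Import structures.
From mathcomp Require Import all_boot all_order all_algebra.
From mathcomp Require Import boolp classical_sets functions cardinality.
From mathcomp Require Import zify ring.

Set Implicit Arguments.
Unset Strict Implicit.
Unset Printing Implicit Defensive.

Import GRing.Theory.
Local Open Scope ring_scope.
Local Open Scope classical_set_scope.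

(** * Hopf algebras and module algebras *)

(** A presentation only provides maps out of an algebra, and elements of a tensor square are visible
    only through bilinear maps. Nonvanishing in [H] is therefore shown by exhibiting actions, and
    identities for [comul] are proved under an arbitrary bilinear [f]. No quotient Hopf algebra is
    formed: in place of the ideal generated by [x] stands the kernel of the idempotent endomorphism
    that fixes [y] and kills [x]. Actions are built by sending the generators to weighted cyclic
    shifts. The relations become scalar identities, and the Leibniz rule need only be checked on
    generators. The equation [q ^+ (1 + j0 * t) = 1], extracted from one given action, does more
    than yield [t %| m]: it also makes the [N]-th powers of the shifts for [x] and for [X] vanish.
    In turn [t %| m] both provides a root of [lam ^+ t = q^-1] among the powers of [zeta] and makes
    [lam ^+ n = 1] automatic, so that [Y ^+ n = 1] imposes nothing further. *)

Lemma presented_ind (k : fieldType) (rel : forall B : algType k, seq B -> Prop)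
    (H : algType k) (gs : seq H) (P : H -> Prop) :
  presented_by rel gs -> P 1 ->
  (forall (c : k) g h, P g -> P h -> P (c *: g + h)) ->
  (forall g h, P g -> P h -> P (g * h)) ->
  (forall g, g \in gs -> P g) -> forall h, P h.
Proof.
move=> [_ gen _] P1 PL PM Pg h.
have /asboolP // : h \in [pred h | `[< P h >]].
apply: gen => [|g gP]; last by apply/asboolP/Pg.
split; first exact/asboolP.
- by move=> c g g' /asboolP Pg1 /asboolP Pg2; apply/asboolP/PL.
- by move=> g g' /asboolP Pg1 /asboolP Pg2; apply/asboolP/PM.
Qed.

Section LinearFunctions.
Variables (k : fieldType) (U V : lmodType k) (f : U -> V).
Hypothesis fl : linear f.

Let F : {linear U -> V} := HB.pack f (GRing.isLinear.Build k U V _ f fl).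

Lemma lfun_0 : f 0 = 0. Proof. exact: (linear0 F). Qed.

Lemma lfun_D a b : f (a + b) = f a + f b. Proof. exact: (linearD F). Qed.

Lemma lfun_B a b : f (a - b) = f a - f b. Proof. exact: (linearB F). Qed.

Lemma lfun_Z c a : f (c *: a) = c *: f a. Proof. exact: (linearZZ F). Qed.

Lemma lfun_sum I (r : seq I) (P : pred I) E :
  f (\sum_(i <- r | P i) E i) = \sum_(i <- r | P i) f (E i).
Proof. exact: (linear_sum F). Qed.

End LinearFunctions.

Section HopfTheory.
Variables (k : fieldType) (H : hopfAlgebra k).
Implicit Types (g h c : H).

Section ComulSums.
Variables (U : lmodType k) (f : H -> H -> U).
Hypothesis bf : bilinear_for *:%R *:%R f.

Let fl (v : H) : linear (f^~ v). Proof. exact: bf.1. Qed.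

Lemma sum_comulP (a : k) g h :
  \sum_(p <- comul (a *: g + h)) f p.1 p.2 =
    a *: (\sum_(p <- comul g) f p.1 p.2) + \sum_(p <- comul h) f p.1 p.2.
Proof.
rewrite (comul_linear a g h bf) big_cat big_map scaler_sumr /=.
congr (_ + _); apply: eq_bigr => p _.
have f0 v : f 0 v = 0.
  have /(congr1 (fun z => z - f 0 v)) := fl v 1 0 0.
  by rewrite scale1r add0r subrr scale1r addrK.
by have := fl p.2 a p.1 0; rewrite !addr0 f0 addr0.
Qed.

Lemma sum_comulM g h :
  \sum_(p <- comul (g * h)) f p.1 p.2 =
  \sum_(p <- comul g) \sum_(q <- comul h) f (p.1 * q.1) (p.2 * q.2).
Proof.
rewrite (comulM g h bf) big_allpairs_dep /=.
by apply: eq_bigr => p _; apply: eq_bigr.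
Qed.

Lemma sum_comul1 : \sum_(p <- comul (1 : H)) f p.1 p.2 = f 1 1.
Proof. by rewrite (@comul1 _ H _ _ bf) big_seq1. Qed.

Lemma sum_comul_grouplike g : grouplike g ->
  \sum_(p <- comul g) f p.1 p.2 = f g g.
Proof. by move=> [_ /(_ _ _ bf) ->]; rewrite big_seq1. Qed.

Lemma sum_comul_skew g h c : skew_primitive g h c ->
  \sum_(p <- comul c) f p.1 p.2 = f g c + f c h.
Proof. by move=> /(_ _ _ bf) ->; rewrite big_cons big_seq1. Qed.

End ComulSums.

Lemma counitl_bilinear :
  bilinear_for *:%R *:%R (fun g h => (counit g : k) *: h).
Proof.
split=> v a b c /=; first by rewrite linearP scalerDl scalerA.
by rewrite scalerDr !scalerA mulrC.
Qed.

Lemma counitr_bilinear :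
  bilinear_for *:%R *:%R (fun g h => (counit h : k) *: g).
Proof.
split=> v a b c /=; first by rewrite scalerDr !scalerA mulrC.
by rewrite linearP scalerDl scalerA.
Qed.

Lemma counit_grouplike g : grouplike g -> (counit g : k) = 1.
Proof.
move=> gg; have := counit_comul_l g.
rewrite (sum_comul_grouplike counitl_bilinear gg) => eg.
have : ((counit g : k) - 1) *: g = 0 by rewrite scalerBl scale1r eg subrr.
by move/eqP; rewrite scaler_eq0 (negPf gg.1) orbF subr_eq0 => /eqP.
Qed.

Lemma counit_skew1r g c : grouplike g -> skew_primitive g 1 c ->
  (counit c : k) = 0.
Proof.
move=> gg sc; have := counit_comul_l c.
rewrite (sum_comul_skew counitl_bilinear sc) (counit_grouplike gg) scale1r.
move/(congr1 (fun z => z - c)); rewrite subrr addrC addKr => /eqP.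
by rewrite scaler_eq0 oner_eq0 orbF => /eqP.
Qed.

Lemma counit_skew1l h c : grouplike h -> skew_primitive 1 h c ->
  (counit c : k) = 0.
Proof.
move=> gh sc; have := counit_comul_r c.
rewrite (sum_comul_skew counitr_bilinear sc) (counit_grouplike gh) scale1r.
move/(congr1 (fun z => z - c)); rewrite subrr addrK => /eqP.
by rewrite scaler_eq0 oner_eq0 orbF => /eqP.
Qed.

Lemma grouplikeX g i : grouplike g -> grouplike (g ^+ i).
Proof.
move=> gg; split.
  have e1 : (counit (g ^+ i) : k) = 1.
    by rewrite rmorphXn /= counit_grouplike // expr1n.
  apply: contra_eq_neq e1 => ->; rewrite raddf0 eq_sym; exact: oner_neq0.
move=> U f bf; rewrite big_seq1 /=.
elim: i U f bf => [|i IH] U f bf; first by rewrite expr0 sum_comul1.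
rewrite exprS sum_comulM //.
have bf2 : bilinear_for *:%R *:%R (fun a b => f (a * g ^+ i) (b * g ^+ i)).
  split=> v a b c /=; rewrite mulrDl -scalerAl; [exact: bf.1 | exact: bf.2].
rewrite -(sum_comul_grouplike bf2 gg); apply: eq_bigr => p _.
apply: (IH _ (fun a b => f (p.1 * a) (p.2 * b))).
split=> v a b c /=; rewrite mulrDr -scalerAr; [exact: bf.1 | exact: bf.2].
Qed.

Section Action.
Variables (A : algType k) (act : H -> A -> A).
Hypothesis bact : bilinear_for *:%R *:%R act.

Lemma act_linear h : linear (act h). Proof. exact: bact.2. Qed.

Lemma act_bilinear2 (a b : A) :
  bilinear_for *:%R *:%R (fun g h => act g a * act h b).
Proof.
split=> v c g h /=.
  by rewrite (bact.1 a c g h) mulrDl -scalerAl.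
by rewrite (bact.1 b c g h) mulrDr -scalerAr.
Qed.

(** The elements of [H] that obey both axioms form a subalgebra, because [comul] and [counit] are
    multiplicative. *)
Lemma module_algebra_gen (rel : forall B : algType k, seq B -> Prop) gs :
  presented_by rel gs -> (forall a, act 1 a = a) ->
  (forall g h a, act (g * h) a = act g (act h a)) ->
  (forall g, g \in gs -> forall a b,
    act g (a * b) = \sum_(p <- comul g) act p.1 a * act p.2 b) ->
  (forall g, g \in gs -> act g 1 = (counit g : k)%:A) ->
  module_algebra act.
Proof.
move=> gen act1 actM actX actU; split=> //.
- move=> h a b; move: h a b; apply: (presented_ind gen).
  + by move=> a b; rewrite (sum_comul1 (act_bilinear2 a b)) !act1.
  + move=> c g h IHg IHh a b.
    by rewrite (sum_comulP (act_bilinear2 a b)) -IHg -IHh; exact: bact.1.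
  + move=> g h IHg IHh a b.
    rewrite (sum_comulM (act_bilinear2 a b)) actM IHh.
    rewrite (lfun_sum (act_linear g)) exchange_big /=.
    apply: eq_bigr => p _; rewrite IHg; apply: eq_bigr => q _.
    by rewrite !actM.
  + exact: actX.
- apply: (presented_ind gen).
  + by rewrite act1 rmorph1 scale1r.
  + move=> c g h IHg IHh.
    rewrite (bact.1 1 c g h) IHg IHh linearP scalerDl /=.
    by rewrite -[c *: counit g]/(c * counit g) scalerA.
  + move=> g h IHg IHh; rewrite actM IHh.
    by rewrite (lfun_Z (act_linear g)) IHg rmorphM scalerA mulrC.
  + exact: actU.
Qed.

End Action.
End HopfTheory.

Section ModuleAlgebraTheory.
Variables (k : fieldType) (H : hopfAlgebra k) (A : algType k).
Variable act : H -> A -> A.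
Hypothesis modA : module_algebra act.

Let bact : bilinear_for *:%R *:%R act. Proof. by case: modA. Qed.

Lemma act_grouplike g : grouplike g -> monoid_morphism (act g).
Proof.
case: (modA) => _ _ _ actX actU gg; split=> [|a b].
  by rewrite actU counit_grouplike // scale1r.
by rewrite actX (sum_comul_grouplike (act_bilinear2 bact a b) gg).
Qed.

Lemma act_grouplikeX g a i : grouplike g -> act g (a ^+ i) = act g a ^+ i.
Proof.
move=> /act_grouplike[act1 actM].
by elim: i => [|i IH]; rewrite ?expr0 // !exprS actM IH.
Qed.

Lemma act_expr h a i : act (h ^+ i) a = iter i (act h) a.
Proof.
case: (modA) => _ act1 actM _ _.
by elim: i => [|i IH]; rewrite ?expr0 // exprS actM IH.
Qed.

Lemma act_skew g h c a b : skew_primitive g h c ->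
  act c (a * b) = act g a * act c b + act c a * act h b.
Proof.
case: (modA) => _ _ _ actX _ sc.
by rewrite actX (sum_comul_skew (act_bilinear2 bact a b) sc).
Qed.

End ModuleAlgebraTheory.

Lemma module_algebra_ext (k : fieldType) (H : hopfAlgebra k) (A : algType k)
    (rel : forall B : algType k, seq B -> Prop) (gs : seq H)
    (act1 act2 : H -> A -> A) :
  presented_by rel gs -> module_algebra act1 -> module_algebra act2 ->
  (forall g, g \in gs -> act1 g =1 act2 g) -> act1 = act2.
Proof.
move=> gen [b1 u1 M1 _ _] [b2 u2 M2 _ _] eq12.
apply/funext => h; apply/funext; move: h; apply: (presented_ind gen).
- by move=> a; rewrite u1 u2.
- by move=> c g h IHg IHh a; rewrite (b1.1 a c g h) (b2.1 a c g h) /= IHg IHh.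
- by move=> g h IHg IHh a; rewrite M1 M2 IHh IHg.
- exact: eq12.
Qed.

(** * Linear maps on k[u]/(u^n - 1) *)

Section CyclicBasis.
Variables (k : fieldType) (n' : nat).
Local Notation n := n'.+1.

Definition cyc_col (i : nat) : 'cV[k]_n := delta_mx (inord (i %% n)) 0.

(** A weighted cyclic shift, sending [u ^+ i] to [f i *: u ^+ (i + s)]. Only the values of [f] below
    [n] enter, so the lemmas ask [f] to be [n]-periodic. *)
Definition cyc_mx (f : nat -> k) (s : nat) : 'M[k]_n :=
  \matrix_(a, b) (f b *+ ((a : nat) == (b + s) %% n)%N).

Lemma cyc_mxE f s i : (forall j, f (j %% n)%N = f j) ->
  cyc_mx f s *m cyc_col i = f i *: cyc_col (i + s).
Proof.
move=> fn; apply/matrixP => a b; rewrite -colE !mxE (ord1 b) eqxx andbT.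
rewrite inordK ?ltn_pmod // fn modnDml mulr_natr; congr (_ *+ nat_of_bool _).
by rewrite -val_eqE /= inordK ?ltn_pmod.
Qed.

Lemma cyc_mx_ext (M M' : 'M[k]_n) :
  (forall i, M *m cyc_col i = M' *m cyc_col i) -> M = M'.
Proof.
move=> eqM; apply/matrixP => a b; have /matrixP/(_ a 0) := eqM b.
by rewrite /cyc_col modn_small // inord_val -!colE !mxE.
Qed.

(** Coordinates are columns so that square matrices act on [A]; the matrix algebra can then be a
    target for the universal property of a presentation. *)
Definition cyclic_basis (A : algType k) (u : A) (vec : A -> 'cV[k]_n)
    (unvec : 'cV[k]_n -> A) : Prop :=
  [/\ linear vec, linear unvec, cancel vec unvec, cancel unvec vec &
      forall i, unvec (cyc_col i) = u ^+ i].

Section Theory.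
Variables (A : algType k) (u : A) (vec : A -> 'cV[k]_n).
Variable unvec : 'cV[k]_n -> A.
Hypothesis basis : cyclic_basis u vec unvec.

Let lvec : linear vec. Proof. by case: basis. Qed.
Let lunvec : linear unvec. Proof. by case: basis. Qed.
Let vecK : cancel vec unvec. Proof. by case: basis. Qed.
Let unvecK : cancel unvec vec. Proof. by case: basis. Qed.
Let unvec_col i : unvec (cyc_col i) = u ^+ i. Proof. by case: basis. Qed.

Lemma basis_span a : a = \sum_(i < n) vec a i 0 *: u ^+ i.
Proof.
rewrite -{1}[a]vecK [X in unvec X]matrix_sum_delta (lfun_sum lunvec).
apply: eq_bigr => i _; rewrite big_ord1 (lfun_Z lunvec) -unvec_col.
by rewrite /cyc_col modn_small // inord_val.
Qed.

Lemma basis_ext (U : lmodType k) (f g : A -> U) : linear f -> linear g ->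
  (forall i, f (u ^+ i) = g (u ^+ i)) -> f =1 g.
Proof.
move=> fl gl eqfg a; rewrite [a]basis_span (lfun_sum fl) (lfun_sum gl).
by apply: eq_bigr => i _; rewrite (lfun_Z fl) (lfun_Z gl) eqfg.
Qed.

Lemma basis_expmod i j : i = j %[mod n] -> u ^+ i = u ^+ j.
Proof. by move=> eq_ij; rewrite -!unvec_col /cyc_col eq_ij. Qed.

Lemma cyc_col_neq0 i : cyc_col i != 0.
Proof.
apply/eqP => /matrixP /(_ (inord (i %% n)) 0).
by rewrite !mxE !eqxx /=; apply/eqP/oner_neq0.
Qed.

Lemma basis_neq0 i : u ^+ i != 0.
Proof.
rewrite -unvec_col -(lfun_0 lunvec) (inj_eq (can_inj unvecK)).
exact: cyc_col_neq0.
Qed.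

Lemma basis_scaleI i : injective (fun c => c *: u ^+ i).
Proof.
move=> c d /= /eqP; rewrite -subr_eq0 -scalerBl scaler_eq0.
by rewrite (negPf (basis_neq0 i)) orbF subr_eq0 => /eqP.
Qed.

Definition coef i a : k := vec a (inord (i %% n)) 0.

Lemma coef_linear i : linear (coef i : A -> k^o).
Proof. by move=> c a b; rewrite /coef lvec !mxE. Qed.

Lemma coef_basis i j : coef i (u ^+ j) = (i == j %[mod n])%:R.
Proof.
rewrite /coef -unvec_col unvecK mxE eqxx andbT -val_eqE /=.
by rewrite !inordK ?ltn_pmod.
Qed.

Lemma coef_ext a b : (forall i, coef i a = coef i b) -> a = b.
Proof.
move=> eqab; apply: (can_inj vecK); apply/matrixP => i j.
by rewrite (ord1 j); have := eqab i; rewrite /coef modn_small // inord_val.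
Qed.

(** The eigenvalues [z ^+ j] are distinct for [j] modulo [n], so comparing coordinates in the
    eigenvalue equation kills every one but the [i]-th. *)
Lemma weight_space (z : k) (f : A -> A) i a : n.-primitive_root z ->
  linear f -> (forall j, f (u ^+ j) = z ^+ j *: u ^+ j) ->
  f a = z ^+ i *: a -> a = coef i a *: u ^+ i.
Proof.
move=> prz fl fu fa; apply: coef_ext => j.
rewrite (lfun_Z (coef_linear j)) coef_basis -[LHS]/(coef j a : k^o).
have coef_f b : coef j (f b) = z ^+ j * coef j b.
  apply: (basis_ext (f := fun b => coef j (f b) : k^o)
                    (g := fun b => z ^+ j *: (coef j b : k^o))).
  - by move=> c b1 b2; rewrite fl coef_linear.
  - by move=> c b1 b2; rewrite coef_linear scalerDr !scalerA mulrC.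
  - move=> l; rewrite fu (lfun_Z (coef_linear j)) coef_basis.
    have [eq_jl|] := eqVneq (j %% n)%N (l %% n)%N; last by rewrite !scaler0.
    by congr (_ *: _); apply/eqP; rewrite (eq_prim_root_expr prz) eq_jl.
have [eq_ji|ne_ji] := eqVneq (j %% n)%N (i %% n)%N.
  by rewrite /coef eq_ji; exact: (esym (mulr1 _)).
have := coef_f a; rewrite fa (lfun_Z (coef_linear j)) => /eqP.
rewrite -[_ *: _]/(z ^+ i * coef j a) -subr_eq0 -mulrBl mulf_eq0 subr_eq0.
by rewrite (eq_prim_root_expr prz) eq_sym (negPf ne_ji) scaler0 => /eqP.
Qed.

Definition mx_act (M : 'M[k]_n) (a : A) : A := unvec (M *m vec a).

Lemma mx_act_bilinear : bilinear_for *:%R *:%R mx_act.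
Proof.
split=> v c a b /=; rewrite /mx_act.
  by rewrite mulmxDl -scalemxAl lunvec.
by rewrite lvec mulmxDr -scalemxAr lunvec.
Qed.

Lemma mx_act1 a : mx_act 1 a = a.
Proof. by rewrite /mx_act mul1mx vecK. Qed.

Lemma mx_actM M M' a : mx_act (M * M') a = mx_act M (mx_act M' a).
Proof. by rewrite /mx_act unvecK mulmxA. Qed.

Lemma mx_act_cyc f s i : (forall j, f (j %% n)%N = f j) ->
  mx_act (cyc_mx f s) (u ^+ i) = f i *: u ^+ (i + s).
Proof.
by move=> fn; rewrite /mx_act -!unvec_col unvecK cyc_mxE // (lfun_Z lunvec).
Qed.

End Theory.

Lemma qpoly_cyclic_basis (A : algType k)
    (phi : {lrmorphism {poly %/ ('X^n - 1 : {poly k})} -> A}) :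
  bijective phi -> exists vec unvec, cyclic_basis (phi 'qX) vec unvec.
Proof.
set h : {poly k} := 'X^n - 1 => -[psi phiK psiK].
have sh : size h = n.+1 by rewrite /h -polyC1 size_XnsubC.
have h_monic : h \is monic by rewrite /h -polyC1 monicXnsubC.
(* The quotient reduces modulo [mk_monic h], which is [h] itself because [h] is monic of size above
   1. *)
have eh : mk_monic h = h by rewrite /mk_monic sh /= h_monic.
pose vec a : 'cV[k]_n := \col_(i < n) (psi a : {poly k})`_i.
pose unvec (v : 'cV[k]_n) := phi (in_qpoly h (\sum_(i < n) v i 0 *: 'X^i)).
exists vec, unvec.
have psi_linear : linear psi.
  by move=> c a b; rewrite -{1}[a]psiK -{1}[b]psiK -linearP phiK.
have sum_small (v : 'cV[k]_n) :
    in_qpoly h (\sum_(i < n) v i 0 *: 'X^i) = \sum_(i < n) v i 0 *: 'X^i :> {poly k}.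
  apply: in_qpoly_small; rewrite eh sh ltnS; apply: (leq_trans (size_sum _ _ _)).
  apply/bigmax_leqP => i _; apply: leq_trans (size_scale_leq _ _) _.
  by rewrite size_polyXn.
have coef_sumX (v : 'cV[k]_n) (i : 'I_n) : (\sum_(j < n) v j 0 *: 'X^j)`_i = v i 0.
  rewrite coef_sum (bigD1 i) //= coefZ coefXn eqxx mulr1 big1 ?addr0 // => j ne_ji.
  by rewrite coefZ coefXn eq_sym (inj_eq val_inj) (negPf ne_ji) mulr0.
split.
- by move=> c a b; apply/matrixP => i j; rewrite !mxE psi_linear coefD coefZ.
- move=> c v w; rewrite /unvec -!linearP; congr (phi (in_qpoly h _)).
  rewrite scaler_sumr -big_split; apply: eq_bigr => i _ /=.
  by rewrite !mxE scalerDl scalerA.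
- move=> a; rewrite -[RHS]psiK /unvec; congr (phi _); apply: val_inj => /=.
  rewrite -[LHS]/(in_qpoly h _ : {poly k}) sum_small.
  apply/polyP => i; have [lt_in|le_ni] := ltnP i n.
    by rewrite -[i]/(val (Ordinal lt_in)) coef_sumX mxE.
  rewrite !nth_default //.
    apply: leq_trans le_ni; rewrite -ltnS -sh.
    by apply: leq_trans (size_mk_monic (psi a)) _; rewrite eh.
  apply: leq_trans le_ni; apply: (leq_trans (size_sum _ _ _)).
  apply/bigmax_leqP => j _; apply: leq_trans (size_scale_leq _ _) _.
  by rewrite size_polyXn.
- move=> v; apply/matrixP => i j.
  by rewrite mxE phiK sum_small coef_sumX (ord1 j).
- move=> i; have Xn1 : ('qX : {poly %/ h}) ^+ n = 1.
    rewrite /qpolyX -rmorphXn /= -[X in in_qpoly h X](subrK 1) -/h.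
    rewrite raddfD /= in_qpoly1 -[RHS]add0r; congr (_ + _).
    by apply: val_inj => /=; rewrite eh Pdiv.RingMonic.rmodpp.
  rewrite -rmorphXn /= (divn_eq i n) exprD mulnC exprM Xn1 expr1n mul1r.
  rewrite /unvec /cyc_col; congr (phi _); rewrite -rmorphXn /=; congr (in_qpoly h _).
  rewrite mulnC modnMDl modn_mod (bigD1 (inord (i %% n))) //= mxE !eqxx scale1r.
  rewrite inordK ?ltn_pmod // big1 ?addr0 // => j ne_ji.
  by rewrite mxE (negPf ne_ji) scale0r.
Qed.

End CyclicBasis.

(** * Hopf ideals *)

Section EndomorphismKernel.
Variables (k : fieldType) (H : hopfAlgebra k).
Variables (rel : forall B : algType k, seq B -> Prop) (gs : seq H).
Hypothesis gen : presented_by rel gs.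
Variable pi : {lrmorphism H -> H}.
Hypothesis pi_idem : forall g, g \in gs -> pi (pi g) = pi g.
Hypothesis pi_counit : forall g, g \in gs -> counit (pi g) = counit g.
Hypothesis pi_comul : forall g, g \in gs ->
  forall (U : lmodType k) (f : H -> H -> U), bilinear_for *:%R *:%R f ->
  \sum_(p <- comul (pi g)) f p.1 p.2 = \sum_(p <- comul g) f (pi p.1) (pi p.2).

Let pi_idemE h : pi (pi h) = pi h.
Proof.
move: h; apply: (presented_ind gen) => //; first by rewrite !rmorph1.
  by move=> c g h eg eh; rewrite !linearP /= eg eh.
by move=> g h eg eh; rewrite !rmorphM /= eg eh.
Qed.

Let pi_counitE h : counit (pi h) = counit h.
Proof.
move: h; apply: (presented_ind gen) => //; first by rewrite !rmorph1.
  by move=> c g h eg eh; rewrite !linearP /= eg eh.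
by move=> g h eg eh; rewrite !rmorphM /= eg eh.
Qed.

Let bilinear_pi (U : lmodType k) (f : H -> H -> U) :
  bilinear_for *:%R *:%R f ->
  bilinear_for *:%R *:%R (fun a b => f (pi a) (pi b)).
Proof.
move=> bf; split=> v c a b /=; rewrite linearP /=; [exact: bf.1 | exact: bf.2].
Qed.

Let pi_comulE h : forall (U : lmodType k) (f : H -> H -> U),
  bilinear_for *:%R *:%R f ->
  \sum_(p <- comul (pi h)) f p.1 p.2 = \sum_(p <- comul h) f (pi p.1) (pi p.2).
Proof.
move: h; apply: (presented_ind gen) => //.
- move=> U f bf; rewrite rmorph1 (sum_comul1 bf).
  by rewrite (sum_comul1 (bilinear_pi bf)) rmorph1.
- move=> c g h eg eh U f bf; rewrite linearP /= (sum_comulP bf).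
  by rewrite (sum_comulP (bilinear_pi bf)) eg // eh.
- move=> g h eg eh U f bf; rewrite rmorphM /= (sum_comulM bf).
  rewrite (sum_comulM (bilinear_pi bf)) /=.
  have bf2 a b : bilinear_for *:%R *:%R (fun v w => f (a * v) (b * w)).
    split=> v c u w /=; rewrite mulrDr -scalerAr; [exact: bf.1 | exact: bf.2].
  under eq_bigr => p _ do rewrite (eh _ _ (bf2 p.1 p.2)).
  have bf3 : bilinear_for *:%R *:%R (fun v w =>
      \sum_(p <- comul h) f (v * pi p.1) (w * pi p.2)).
    split=> v c u w /=; rewrite scaler_sumr -big_split; apply: eq_bigr => p _;
    rewrite mulrDl -scalerAl; [exact: bf.1 | exact: bf.2].
  rewrite (eg _ _ bf3); apply: eq_bigr => p _; apply: eq_bigr => q _.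
  by rewrite !rmorphM.
Qed.

(** Both composites are convolution inverses of [pi]: coassociativity applied to [F] contracts the
    same triple product from the left and from the right. *)
Let pi_antipode h : pi (antipode h) = antipode (pi h).
Proof.
have pi_alg c : pi c%:A = c%:A by rewrite linearZ /= rmorph1.
pose F a b c := pi (antipode a) * pi b * antipode (pi c).
have triF : trilinear F.
  split=> [b c|a c|a b] s u v; rewrite /F !linearP /=.
  - by rewrite !mulrDl -!scalerAl.
  - by rewrite mulrDr mulrDl -scalerAr -scalerAl.
  - by rewrite mulrDr -scalerAr.
have := comulA triF h.
under eq_bigr => p _.
  rewrite /F -mulr_suml.
  under eq_bigr => q _ do rewrite -rmorphM.
  rewrite -rmorph_sum antipode_comul_l /= pi_alg -scalerAl mul1r.
  over.
have -> : \sum_(p <- comul h) (counit p.1 : k) *: antipode (pi p.2) =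
          antipode (pi h).
  rewrite -[in RHS](counit_comul_l h) rmorph_sum linear_sum /=.
  by apply: eq_bigr => p _; rewrite linearZ linearZ.
move->.
transitivity (\sum_(p <- comul h) (counit p.2 : k) *: pi (antipode p.1)).
  rewrite -[in LHS](counit_comul_r h) linear_sum rmorph_sum /=.
  by apply: eq_bigr => p _; rewrite linearZ linearZ.
apply: eq_bigr => p _.
under eq_bigr => q _ do rewrite /F -mulrA.
rewrite -mulr_sumr.
rewrite -(pi_comulE p.2 (f := fun a b => a * antipode b)); last first.
  split=> v c u w /=; first by rewrite mulrDl -scalerAl.
  by rewrite linearP mulrDr -scalerAr.
by rewrite antipode_comul_r pi_counitE -scalerAr mulr1.
Qed.

Lemma hopf_ideal_ker : hopf_ideal [pred h | pi h == 0].
Proof.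
split.
- split=> [|c g h]; rewrite !inE ?raddf0 // => /eqP eg /eqP eh.
  by rewrite linearP /= eg eh scaler0 addr0.
- by move=> g h; rewrite !inE !rmorphM /= => /eqP ->; rewrite mulr0 mul0r eqxx.
- move=> h /eqP ph.
  (* Write a (x) b as (a - pi a) (x) b + pi a (x) (b - pi b) + pi a (x) pi b. Idempotence puts both
     differences in the kernel, and the last terms add up to the coproduct of [pi h], which is
     zero. *)
  exists ([seq (p.1 - pi p.1, p.2) | p <- comul h] ++
          [seq (pi p.1, p.2 - pi p.2) | p <- comul h]).
    move=> U f bf; rewrite big_cat /= !big_map -big_split /=.
    have := pi_comulE h bf; rewrite ph.
    have -> : \sum_(p <- comul 0) f p.1 p.2 = 0.
      have := sum_comulP bf (-1) 0 0; rewrite scaler0 addr0 scaleN1r.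
      by rewrite addNr.
    move/(congr1 (fun z => \sum_(p <- comul h) f p.1 p.2 - z)).
    rewrite subr0 => ->; rewrite -sumrB; apply: eq_bigr => p _.
    by rewrite (lfun_B (bf.1 p.2)) (lfun_B (bf.2 (pi p.1))) addrA subrK.
  move=> p; rewrite mem_cat => /orP[] /mapP[q _ ->] /=; [left|right];
  by rewrite inE rmorphB /= pi_idemE subrr.
- by move=> h /eqP ph; rewrite -pi_counitE ph ?rmorph0 ?raddf0.
- by move=> h /eqP ph; rewrite inE pi_antipode ph ?rmorph0 ?raddf0.
Qed.

End EndomorphismKernel.

(** * The projection of H that kills x *)

Section HnIdeal.
Variables (k : fieldType) (n m t N : nat) (zeta : k).
Hypotheses (N_gt1 : (1 < N)%N) (zetan : zeta ^+ n = 1).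
Variables (H : hopfAlgebra k) (y x : H).
Hypothesis HnP : is_Hn n m t N zeta y x.

(** There is a two-dimensional representation with [y] acting as diag([zeta ^+ t], 1) and [x] as a
    matrix unit; the latter has square zero, which suffices for [x ^+ N = 0] because [1 < N]. *)
Lemma Hn_x_neq0 : x != 0.
Proof.
have [[_ _ univ] _ _] := HnP.
pose my : 'M[k]_2 := \matrix_(i, j) (if i == j then zeta ^+ (t * (i == 0)) else 0).
pose mx : 'M[k]_2 := delta_mx 0 1.
have mx2 : mx * mx = 0 by rewrite /mx -[_ * _]/(_ *m _) mul_delta_mx_0.
have myX i : my ^+ i = \matrix_(a, b) (if a == b then zeta ^+ (t * (a == 0) * i) else 0).
  elim: i => [|i IH].
    by apply/matrixP => a b; rewrite expr0 -[1]/(1%:M) !mxE muln0 expr0; case: eqP.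
  rewrite exprS IH -[_ * _]/(_ *m _); apply/matrixP => a b; rewrite !mxE.
  rewrite (bigD1 a) //= !mxE eqxx big1 ?addr0 => [|j /negPf ne_ja].
    by have [_|_] := eqVneq a b; rewrite ?mulr0 // mulnS exprD.
  by rewrite !mxE eq_sym ne_ja mul0r.
have [|phi [_ ephi]] := univ _ [:: my; mx].
  split.
  - rewrite myX; apply/matrixP => a b; rewrite !mxE.
    by have [_|_] := eqVneq a b; rewrite // mulnC exprM zetan expr1n.
  - by rewrite -(subnK N_gt1) exprD expr2 mx2 mulr0.
  - rewrite -![_ * _]/(_ *m _); apply/matrixP => a b; rewrite !mxE.
    rewrite (bigD1 a) //= [X in _ + X]big1 => [|j /negPf ne_ja]; last first.
      by rewrite !mxE eq_sym ne_ja mul0r.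
    rewrite (bigD1 b) //= [X in _ = _ * (_ + X)]big1 => [|j /negPf ne_jb]; last first.
      by rewrite !mxE ne_jb mulr0.
    rewrite !mxE !eqxx !addr0.
    case: (a == 0); last by rewrite mulr0 mul0r mulr0.
    case: (b =P 1) => [->|_]; last by rewrite mulr0 mul0r mulr0.
    by rewrite /= muln1 muln0 expr0 !mulr1.
apply/eqP => x0; move: ephi; rewrite x0 raddf0 => /matrixP /(_ 0 1).
by rewrite !mxE !eqxx /= => /eqP; rewrite eq_sym (negPf (oner_neq0 _)).
Qed.

(** If [x] acted by zero, the action would factor through the endomorphism [phi] with [y] fixed and
    [x] killed. Its kernel is a Hopf ideal that annihilates [A] and contains the nonzero element
    [x]. *)
Lemma inner_faithful_x (A : algType k) (act : H -> A -> A) :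
  module_algebra act -> inner_faithful act -> exists a, act x a != 0.
Proof.
move=> modA inner; apply: contrapT => nex.
have x0 a : act x a = 0.
  by apply/eqP/negPn/negP => xa; apply: nex; exists a.
have [gen gy sx] := HnP; have [[relyn relxN relyx] _ univ] := gen.
have [|phi [phiy phix]] := univ _ [:: y; 0].
  by split=> //; rewrite ?expr0n ?gtn_eqF ?(ltnW N_gt1) // mul0r mulr0 scaler0.
have [||h] := inner [pred h | phi h == 0].
- apply: (hopf_ideal_ker gen) => g; rewrite !inE => /orP[]/eqP->;
    rewrite ?phiy ?phix ?raddf0 //.
    by rewrite (counit_skew1r (grouplikeX m gy) sx).
  + move=> U f bf.
    rewrite (sum_comul_grouplike bf gy).
    have bf2 : bilinear_for *:%R *:%R (fun a b => f (phi a) (phi b)).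
      by split=> v c a b /=; rewrite linearP /=; [exact: bf.1 | exact: bf.2].
    by rewrite (sum_comul_grouplike bf2 gy) phiy.
  + move=> U f bf.
    have bf2 : bilinear_for *:%R *:%R (fun a b => f (phi a) (phi b)).
      by split=> v c a b /=; rewrite linearP /=; [exact: bf.1 | exact: bf.2].
    rewrite (sum_comul_skew bf2 sx) phix (lfun_0 (bf.2 _)) (lfun_0 (bf.1 _)).
    have := sum_comulP bf (-1) 0 0; rewrite scaler0 addr0 scaleN1r => ->.
    by rewrite addNr addr0.
- by exists x; rewrite ?inE ?phix // Hn_x_neq0.
rewrite inE => /eqP phih [a /eqP]; apply.
have [bact act1 actM _ _] := modA.
have act_phi g b : act g b = act (phi g) b.
  move: g b; apply: (presented_ind gen).
  - by move=> b; rewrite rmorph1.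
  - move=> c g g' eg eg' b.
    by rewrite linearP /= (bact.1 b c g g') (bact.1 b c (phi g) (phi g')) /= eg eg'.
  - by move=> g g' eg eg' b; rewrite rmorphM /= !actM eg' eg.
  - move=> g; rewrite !inE => /orP[]/eqP-> b; first by rewrite phiy.
    by rewrite phix x0 (lfun_0 (bact.1 b)).
by rewrite act_phi phih (lfun_0 (bact.1 a)).
Qed.

End HnIdeal.

(** * The action of H_n(zeta, m, t) on A(H) *)

Section CyclicMatrices.
Variables (k : fieldType) (n' : nat).
Local Notation n := n'.+1.
Local Notation col := (@cyc_col k n').

Lemma cyc_col_mod i j : i = j %[mod n] -> col i = col j.
Proof. by move=> eq_ij; rewrite /cyc_col eq_ij. Qed.

Lemma cyc_mx_exp f s N i : (forall j, f (j %% n)%N = f j) ->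
  cyc_mx n' f s ^+ N *m col i =
    (\prod_(j < N) f (i + j * s)%N) *: col (i + N * s).
Proof.
move=> fn; elim: N => [|N IH].
  by rewrite expr0 big_ord0 mul1mx scale1r mul0n addn0.
rewrite exprS -[_ * _]/(_ *m _) -mulmxA IH -scalemxAr cyc_mxE // scalerA.
by rewrite big_ord_recr /= mulSnr addnA.
Qed.

Lemma cyc_mx_diag z N i : z ^+ n = 1 ->
  cyc_mx n' (fun i => z ^+ i) 0 ^+ N *m col i = z ^+ (i * N) *: col i.
Proof.
move=> zn; rewrite cyc_mx_exp => [|j]; last by rewrite expr_mod.
rewrite muln0 addn0; congr (_ *: _).
under eq_bigr => j _ do rewrite muln0 addn0.
by rewrite prodr_const card_ord -exprM.
Qed.

End CyclicMatrices.

(** * Automorphisms and skew derivations on powers of u *)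

Section BasisActions.
Variables (k : fieldType) (n' : nat) (A : algType k) (u : A).
Variables (vec : A -> 'cV[k]_n'.+1) (unvec : 'cV[k]_n'.+1 -> A).
Hypothesis basis : cyclic_basis u vec unvec.

Lemma basis_ext2 (U : lmodType k) (f g : A -> A -> U) :
  bilinear_for *:%R *:%R f -> bilinear_for *:%R *:%R g ->
  (forall i j, f (u ^+ i) (u ^+ j) = g (u ^+ i) (u ^+ j)) ->
  forall a b, f a b = g a b.
Proof.
move=> bf bg eqfg a b.
apply: (basis_ext basis (bf.1 b) (bg.1 b)) => i /=.
exact: (basis_ext basis (bf.2 _) (bg.2 _)).
Qed.

Lemma linear_iter_shift (f : A -> A) w s N i : linear f ->
  (forall j, f (u ^+ j) = w j *: u ^+ (j + s)) ->
  iter N f (u ^+ i) = (\prod_(j < N) w (i + j * s)%N) *: u ^+ (i + N * s).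
Proof.
move=> lf fu; elim: N => [|N IH].
  by rewrite big_ord0 scale1r mul0n addn0.
rewrite /= IH (lfun_Z lf) fu scalerA big_ord_recr /=.
by rewrite mulSnr addnA.
Qed.

Variables (H : hopfAlgebra k) (act : H -> A -> A).

Section Construction.
Hypothesis bact : bilinear_for *:%R *:%R act.

Let act_lin h : linear (act h). Proof. exact: bact.2. Qed.

Let bilinear_mul (f g : A -> A) : linear f -> linear g ->
  bilinear_for *:%R *:%R (fun a b => f a * g b).
Proof.
move=> lf lg; split=> v c a b /=.
  by rewrite lf mulrDl -scalerAl.
by rewrite lg mulrDr -scalerAr.
Qed.

Let bilinear_of_mul (f : A -> A) : linear f ->
  bilinear_for *:%R *:%R (fun a b => f (a * b)).
Proof.
move=> lf; split=> v c a b /=.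
  by rewrite mulrDl -scalerAl lf.
by rewrite mulrDr -scalerAr lf.
Qed.

Lemma leibniz_grouplike g z : grouplike g ->
  (forall i, act g (u ^+ i) = z ^+ i *: u ^+ i) -> forall a b,
  act g (a * b) = \sum_(p <- comul g) act p.1 a * act p.2 b.
Proof.
move=> gg gu a b; rewrite (sum_comul_grouplike (act_bilinear2 bact a b) gg).
apply: (basis_ext2 (bilinear_of_mul (act_lin g))
                   (bilinear_mul (act_lin g) (act_lin g))) => i j.
by rewrite -exprD !gu -scalerAl -scalerAr scalerA -!exprD.
Qed.

(** Both sides are bilinear in [a] and [b], so powers of [u] suffice as test elements; on these the
    Leibniz rule is the last condition on [f]. *)
Lemma leibniz_skew g h c z w f s : skew_primitive g h c ->
  (forall i, act g (u ^+ i) = z ^+ i *: u ^+ i) ->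
  (forall i, act h (u ^+ i) = w ^+ i *: u ^+ i) ->
  (forall i, act c (u ^+ i) = f i *: u ^+ (i + s)) ->
  (forall i j, f (i + j)%N = z ^+ i * f j + f i * w ^+ j) -> forall a b,
  act c (a * b) = \sum_(p <- comul c) act p.1 a * act p.2 b.
Proof.
move=> sc gu hu cu fD a b.
rewrite (sum_comul_skew (act_bilinear2 bact a b) sc).
have bD (f1 f2 : A -> A -> A) : bilinear_for *:%R *:%R f1 ->
    bilinear_for *:%R *:%R f2 ->
    bilinear_for *:%R *:%R (fun a b => f1 a b + f2 a b).
  move=> b1 b2; split=> v e a' b' /=.
    by rewrite (b1.1 v e a' b') (b2.1 v e a' b') /= scalerDr addrACA.
  by rewrite (b1.2 v e a' b') (b2.2 v e a' b') /= scalerDr addrACA.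
apply: (basis_ext2 (bilinear_of_mul (act_lin c))
  (bD _ _ (bilinear_mul (act_lin g) (act_lin c))
          (bilinear_mul (act_lin c) (act_lin h)))) => i j.
rewrite /= -exprD !cu gu hu (fD i j) scalerDl.
rewrite -!scalerAl -!scalerAr !scalerA -!exprD.
by rewrite addnA addnAC.
Qed.

End Construction.

Section Formulas.
Hypothesis modA : module_algebra act.

(** Splitting one factor [u] off [u ^+ i.+1] turns the skew Leibniz rule into a recursion governed
    by [f 1]; the start [f 0 = 0] agrees with the value at 1, which the counit dictates. *)
Lemma act_skew_basis g h c z w f s : skew_primitive g h c ->
  (counit c : k) = 0 ->
  (forall i, act g (u ^+ i) = z ^+ i *: u ^+ i) ->
  act h u = w *: u -> act c u = f 1%N *: u ^+ (1 + s) -> f 0 = 0 ->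
  (forall i, f i.+1 = z ^+ i * f 1%N + f i * w) ->
  forall i, act c (u ^+ i) = f i *: u ^+ (i + s).
Proof.
move=> sc c0 gu hu cu f0 fS; elim=> [|i IH].
  by case: modA => _ _ _ _ ->; rewrite c0 f0 !scale0r.
rewrite exprSr (act_skew modA _ _ sc) gu hu cu IH.
rewrite -!scalerAl -!scalerAr !scalerA -exprD -exprSr (fS i) scalerDl.
by rewrite !addSn addnS add0n.
Qed.

Lemma act_grouplike_basis g z : grouplike g -> act g u = z *: u ->
  forall i, act g (u ^+ i) = z ^+ i *: u ^+ i.
Proof. by move=> gg gu i; rewrite (act_grouplikeX modA) // gu exprZn. Qed.

End Formulas.
End BasisActions.

Lemma act_expr_basis (k : fieldType) (H : hopfAlgebra k) (A : algType k)
    (act : H -> A -> A) (u : A) g z N :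
  bilinear_for *:%R *:%R act -> (forall a, act 1 a = a) ->
  (forall g h a, act (g * h) a = act g (act h a)) ->
  (forall i, act g (u ^+ i) = z ^+ i *: u ^+ i) ->
  forall i, act (g ^+ N) (u ^+ i) = (z ^+ N) ^+ i *: u ^+ i.
Proof.
move=> bact act1 actM gu; elim: N => [|N IH] i.
  by rewrite expr0 act1 expr1n scale1r.
by rewrite exprS actM IH (lfun_Z (bact.2 g)) gu scalerA exprS exprMn mulrC.
Qed.

Section HnAction.
Variables (k : fieldType) (n' m t N : nat) (zeta : k).
Local Notation n := n'.+1.
Hypotheses (zeta_prim : n.-primitive_root zeta) (q_neq1 : zeta ^+ m != 1).
Hypothesis N_gt1 : (1 < N)%N.
Variables (H : hopfAlgebra k) (y x : H).
Hypothesis HnP : is_Hn n m t N zeta y x.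
Variables (A : algType k) (act : H -> A -> A).

Lemma Hn_action : is_AH n zeta y act -> exists u vec unvec c,
  [/\ @cyclic_basis k n' A u vec unvec, c != 0,
      forall i, act y (u ^+ i) = zeta ^+ i *: u ^+ i &
      forall i, act x (u ^+ i) = (c * ((zeta ^+ m) ^+ i - 1)) *: u ^+ (i + t)].
Proof.
case=> modA inner [phi [bij_phi yu]].
have [vec [unvec basis]] := qpoly_cyclic_basis bij_phi.
set u := phi 'qX in yu basis; have q1 : zeta ^+ m - 1 != 0 by rewrite subr_eq0.
set q := zeta ^+ m in q1 *.
have [gen gy sx] := HnP; have [[_ _ yx] _ _] := gen.
have [bact act1 actM _ _] := modA.
have actyu := act_grouplike_basis modA gy yu.
(* Dividing by [q - 1] makes the value at [u] the case [i = 1] of [c * (q ^+ i - 1)], the solution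
   of the skew recursion with [y ^+ m] on the left and 1 on the right. *)
pose c := coef vec (1 + t) (act x u) / (q - 1).
have xu : act x u = (c * (q - 1)) *: u ^+ (1 + t).
  rewrite divfK //; apply: (weight_space basis zeta_prim (bact.2 y) actyu).
  rewrite -actM yx (lfun_Z (bact.1 u)) actM yu (lfun_Z (bact.2 x)) scalerA.
  by rewrite -exprSr.
have xui i : act x (u ^+ i) = (c * (q ^+ i - 1)) *: u ^+ (i + t).
  move: i; apply: (act_skew_basis modA (w := 1) (f := fun i => c * (q ^+ i - 1)) sx).
  - exact: (counit_skew1r (grouplikeX m gy) sx).
  - exact: (act_expr_basis m bact act1 actM actyu).
  - by rewrite act1 scale1r.
  - by rewrite expr1.
  - by rewrite expr0 subrr mulr0.
  - by move=> i; rewrite exprSr expr1; ring.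
exists u, vec, unvec, c; split=> //.
have [a] := inner_faithful_x N_gt1 (prim_expr_order zeta_prim) HnP modA inner.
apply: contra_neq => c0.
apply: (basis_ext basis (g := fun=> 0) (bact.2 x)).
  by move=> e b1 b2; rewrite scaler0 addr0.
by move=> i; rewrite xui c0 mul0r scale0r.
Qed.

End HnAction.

(** * Extensions to the double *)

Section Exponents.
Variables (k : fieldType) (n N t j0 : nat) (q : k).
Hypotheses (qt_prim : N.-primitive_root (q ^+ t)).
Hypothesis qj0 : q ^+ (1 + j0 * t) = 1.

(** The [i]-th power of [qj0] has exponent [i + i * j0 * t], and the multiplier of [t] matters only
    modulo [N]. *)
Lemma vanish_up i : exists j : 'I_N, q ^+ (i + j * t) = 1.
Proof.
have N_gt0 := prim_order_gt0 qt_prim.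
exists (Ordinal (ltn_pmod (i * j0) N_gt0)) => /=.
rewrite exprD mulnC exprM (prim_expr_mod qt_prim) -exprM -exprD.
have -> : (i + t * (i * j0) = (1 + j0 * t) * i)%N by ring.
by rewrite exprM qj0 expr1n.
Qed.

(** A step by [n - t] is a step down by [t], and [i * n.-1] plays the part of [-i]; at that exponent
    [vanish_up] amounts to [q ^+ (j * t) = q ^+ i]. *)
Lemma vanish_down i : (0 < n)%N -> q ^+ n = 1 -> (t <= n)%N ->
  exists j : 'I_N, q^-1 ^+ (i + j * (n - t)) = 1.
Proof.
move=> n_gt0 qn le_tn; have q0 : q != 0.
  by apply: contra_eq_neq qj0 => ->; rewrite expr0n eq_sym oner_eq0.
have [j ej] := vanish_up (i * n.-1).
exists j.
have qi : q ^+ (j * t) = q ^+ i.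
  apply: (mulfI (expf_neq0 (i * n.-1) q0)).
  rewrite -!exprD ej -mulnSr prednK // mulnC exprM qn expr1n //.
rewrite exprVn exprD mulnBr; apply/eqP; rewrite invr_eq1; apply/eqP.
have -> : q ^+ (j * n - j * t) = (q ^+ (j * t))^-1.
  apply: (mulIf (expf_neq0 (j * t) q0)); rewrite mulVf ?expf_neq0 //.
  by rewrite -exprD subnK ?leq_mul2l ?le_tn ?orbT // mulnC exprM qn expr1n.
by rewrite qi mulfV // expf_neq0.
Qed.

End Exponents.

Lemma cyc_mx_nilpotent (k : fieldType) n' (f : nat -> k) s N :
  (forall j, f (j %% n'.+1)%N = f j) ->
  (forall i, exists j : 'I_N, f (i + j * s)%N = 0) -> cyc_mx n' f s ^+ N = 0.
Proof.
move=> fn f0; apply: cyc_mx_ext => i; rewrite cyc_mx_exp // mul0mx.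
by have [j fj] := f0 i; rewrite (bigD1 j) //= fj mul0r scale0r.
Qed.

(** * Weighted shifts satisfying the relations of the double *)

Section Relations.
Variables (k : fieldType) (n' m t N j0 : nat) (zeta : k).
Local Notation n := n'.+1.
Local Notation q := (zeta ^+ m).
Local Notation p := (q^-1).
Hypotheses (zetan : zeta ^+ n = 1) (qt_prim : N.-primitive_root (q ^+ t)).
Hypothesis qj0 : q ^+ (1 + j0 * t) = 1.
Variables c d lam : k.

Definition y_mx := cyc_mx n' (fun i => zeta ^+ i) 0.
Definition x_mx := cyc_mx n' (fun i => c * (q ^+ i - 1)) t.
Definition Y_mx := cyc_mx n' (fun i => lam ^+ i) 0.
Definition X_mx := cyc_mx n' (fun i => d * (p ^+ i - 1)) (n - t).

Let qn : q ^+ n = 1. Proof. by rewrite -exprM mulnC exprM zetan expr1n. Qed.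
Let pn : p ^+ n = 1. Proof. by rewrite exprVn qn invr1. Qed.
Let q0 : q != 0.
Proof. by apply: contra_eq_neq qn => ->; rewrite expr0n eq_sym oner_eq0. Qed.
Let zeta0 : zeta != 0.
Proof. by apply: contra_eq_neq zetan => ->; rewrite expr0n eq_sym oner_eq0. Qed.

Lemma y_mxE i : y_mx *m cyc_col k n' i = zeta ^+ i *: cyc_col k n' i.
Proof. by rewrite cyc_mxE ?addn0 // => j; rewrite expr_mod. Qed.

Lemma x_mxE i :
  x_mx *m cyc_col k n' i = (c * (q ^+ i - 1)) *: cyc_col k n' (i + t).
Proof. by rewrite cyc_mxE // => j; rewrite expr_mod. Qed.

Lemma X_mxE i :
  X_mx *m cyc_col k n' i = (d * (p ^+ i - 1)) *: cyc_col k n' (i + (n - t)).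
Proof. by rewrite cyc_mxE // => j; rewrite expr_mod. Qed.

Lemma Hn_rel_mx : Hn_rel n t N zeta [:: y_mx; x_mx].
Proof.
split.
- apply: cyc_mx_ext => i; rewrite cyc_mx_diag // mulnC exprM zetan expr1n.
  by rewrite scale1r mul1mx.
- apply: cyc_mx_nilpotent => [j|i]; first by rewrite expr_mod.
  by have [j ej] := vanish_up qt_prim qj0 i; exists j; rewrite ej subrr mulr0.
- apply: cyc_mx_ext => i; rewrite -scalemxAl -!mulmxA y_mxE x_mxE.
  rewrite -!scalemxAr x_mxE y_mxE !scalerA; congr (_ *: _).
  by rewrite exprD; ring.
Qed.

Hypotheses (lamE : lam ^+ t * q = 1) (t_le_n : (t <= n)%N).
Hypothesis lamn : lam ^+ n = 1.
Hypothesis cdE : q ^+ 2 != 1 -> c * d * (p ^+ t - 1) = 1.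

Lemma Y_mxE i : Y_mx *m cyc_col k n' i = lam ^+ i *: cyc_col k n' i.
Proof. by rewrite cyc_mxE ?addn0 // => j; rewrite expr_mod. Qed.

Let exprB_n (z : k) : z ^+ n = 1 -> z ^+ (n - t) * z ^+ t = 1.
Proof. by move=> zn; rewrite -exprD subnK. Qed.

Lemma double_rel_mx : double_rel n m t N zeta [:: y_mx; Y_mx; x_mx; X_mx].
Proof.
have [yn xN yx] := Hn_rel_mx.
have colB i : cyc_col k n' (i + (n - t) + t) = cyc_col k n' i.
  by apply: cyc_col_mod; rewrite -addnA subnK // modnDr.
have colB' i : cyc_col k n' (i + t + (n - t)) = cyc_col k n' i.
  by rewrite addnAC colB.
have lamB : lam ^+ (n - t) = q.
  have := exprB_n lamn; move/(congr1 (fun z => z * q)).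
  by rewrite -mulrA lamE mulr1 mul1r.
split; [split| split| split| split|] => //.
- apply: cyc_mx_ext => i; rewrite cyc_mx_diag // mulnC exprM lamn expr1n.
  by rewrite scale1r mul1mx.
- apply: cyc_mx_nilpotent => [j|i]; first by rewrite expr_mod.
  have [j ej] := vanish_down qt_prim qj0 i (ltn0Sn n') qn t_le_n.
  by exists j; rewrite ej subrr mulr0.
- apply: cyc_mx_ext => i; rewrite -scalemxAl -!mulmxA Y_mxE X_mxE.
  rewrite -!scalemxAr X_mxE Y_mxE !scalerA; congr (_ *: _).
  by rewrite exprD lamB; ring.
- apply: cyc_mx_ext => i; rewrite -!mulmxA y_mxE Y_mxE.
  by rewrite -!scalemxAr Y_mxE y_mxE !scalerA mulrC.
- apply: cyc_mx_ext => i; rewrite -scalemxAl -!mulmxA Y_mxE x_mxE.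
  rewrite -!scalemxAr x_mxE Y_mxE !scalerA; congr (_ *: _).
  rewrite exprD -[in LHS](mulr1 (lam ^+ i)) -lamE; ring.
- apply: cyc_mx_ext => i; rewrite -scalemxAl -!mulmxA y_mxE X_mxE.
  rewrite -!scalemxAr X_mxE y_mxE !scalerA; congr (_ *: _).
  have -> : zeta ^- t = zeta ^+ (n - t).
    apply: (mulIf (expf_neq0 t zeta0)).
    by rewrite mulVf ?expf_neq0 // exprB_n.
  by rewrite exprD; ring.
- apply: cyc_mx_ext => i; rewrite !mulmxBl -!mulmxA X_mxE x_mxE.
  rewrite -!scalemxAr X_mxE x_mxE !scalerA colB colB' -!scalerBl.
  rewrite !cyc_mx_diag // -scalerBl; congr (_ *: _).
  rewrite exprM mulnC.
  have -> : lam ^+ i ^+ t = p ^+ i.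
    rewrite -exprM mulnC exprM; congr (_ ^+ _).
    by apply: (mulIf q0); rewrite lamE mulVf.
  have -> : zeta ^+ (m * i) = q ^+ i by rewrite exprM.
  have qB : q ^+ (n - t) = p ^+ t.
    apply: (mulIf (expf_neq0 t q0)).
    by rewrite exprB_n // -exprMn mulVf // expr1n.
  rewrite !exprD qB.
  (* Up to sign this product is the difference of the two sides. The second factor vanishes by
     [cdE]; if [q ^+ 2 = 1], then [p = q] and the first factor vanishes whatever [d] is. *)
  have E : (q ^+ i - p ^+ i) * (c * d * (p ^+ t - 1) - 1) = 0.
    have [q2|/cdE->] := eqVneq (q ^+ 2) 1; last by rewrite subrr mulr0.
    have -> : p = q by apply: (mulIf q0); rewrite mulVf // -expr2.
    by rewrite subrr mul0r.
  by apply/eqP; rewrite -subr_eq0; apply/eqP; rewrite -[RHS]oppr0 -E; ring.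
Qed.

End Relations.

(** * Extensions correspond to pairs (lam, d) *)

Section Extensions.
Variables (k : fieldType) (n' m t N : nat) (zeta : k).
Local Notation n := n'.+1.
Local Notation q := (zeta ^+ m).
Local Notation p := (q^-1).
Hypotheses (zeta_prim : n.-primitive_root zeta) (q_neq1 : q != 1).
Hypotheses (qt_prim : N.-primitive_root (q ^+ t)).
Hypothesis t_dvd : (t %| n)%N.
Variables (H : hopfAlgebra k) (yH xH : H).
Hypothesis HnP : is_Hn n m t N zeta yH xH.
Variables (D : hopfAlgebra k) (y Y x X : D).
Hypothesis DP : is_double_Hn n m t N zeta y Y x X.
Variable iota : {lrmorphism H -> D}.
Hypotheses (iota_y : iota yH = y) (iota_x : iota xH = x).
Variables (A : algType k) (act : H -> A -> A).
Hypothesis modA : module_algebra act.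
Variables (u : A) (vec : A -> 'cV[k]_n) (unvec : 'cV[k]_n -> A) (c : k).
Hypotheses (basis : cyclic_basis u vec unvec) (c_neq0 : c != 0).
Hypothesis actyu : forall i, act yH (u ^+ i) = zeta ^+ i *: u ^+ i.
Hypothesis actxu :
  forall i, act xH (u ^+ i) = (c * (q ^+ i - 1)) *: u ^+ (i + t).

Let zetan : zeta ^+ n = 1. Proof. exact: prim_expr_order zeta_prim. Qed.
Let qn : q ^+ n = 1. Proof. by rewrite -exprM mulnC exprM zetan expr1n. Qed.
Let q0 : q != 0.
Proof. by apply: contra_eq_neq qn => ->; rewrite expr0n eq_sym oner_eq0. Qed.
Let zeta0 : zeta != 0.
Proof. by apply: contra_eq_neq zetan => ->; rewrite expr0n eq_sym oner_eq0. Qed.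
Let t_le_n : (t <= n)%N. Proof. exact: dvdn_leq. Qed.

Lemma Hn_exponent : exists j0, q ^+ (1 + j0 * t) = 1.
Proof.
have [[[_ xN _] _ _] _ _] := HnP; have [bact _ _ _ _] := modA.
have := act_expr modA xH (u ^+ 1) N; rewrite xN (lfun_0 (bact.1 _)).
rewrite (linear_iter_shift N 1 (bact.2 xH) actxu) => /esym/eqP.
rewrite scaler_eq0 (negPf (basis_neq0 basis _)) orbF => /eqP/eqP/prodf_eq0[j _].
rewrite mulf_eq0 (negPf c_neq0) subr_eq0 => /eqP qj.
by exists j.
Qed.

(** The order of [zeta] turns the exponent equation into [n %| m * (1 + j0 * t)], and [t] divides
    [n]; modulo [t] the right side is [m]. *)
Lemma dvd_t_m : (t %| m)%N.
Proof.
have [j0 /eqP] := Hn_exponent.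
rewrite -exprM -(prim_order_dvd zeta_prim) => /(dvdn_trans t_dvd).
by rewrite mulnDr muln1 mulnA dvdn_addl // dvdn_mull.
Qed.

(** Raise the hypothesis to the power [n / t]: since [t] also divides [m], the factor coming from
    [q] is a power of [zeta ^+ n]. *)
Lemma lam_expn lam : lam ^+ t * q = 1 -> lam ^+ n = 1.
Proof.
move=> lamE; have [n0 en] := dvdnP t_dvd; have [m0 em] := dvdnP dvd_t_m.
have qn0 : q ^+ n0 = 1.
  by rewrite -exprM em mulnAC -mulnA mulnC -en exprM zetan expr1n.
rewrite en mulnC exprM; move/(congr1 (fun z => z ^+ n0)): lamE.
by rewrite exprMn qn0 mulr1 expr1n.
Qed.

(** The condition on [d] is vacuous when [q ^+ 2 = 1], so a single statement covers the rigid case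
    and the one-parameter case. *)
Lemma ext_exists lam d : lam ^+ t * q = 1 ->
  (q ^+ 2 != 1 -> c * d * (p ^+ t - 1) = 1) ->
  exists actD, [/\ extensions iota act actD,
    forall i, actD Y (u ^+ i) = lam ^+ i *: u ^+ i &
    forall i, actD X (u ^+ i) = (d * (p ^+ i - 1)) *: u ^+ (i + (n - t))].
Proof.
move=> lamE cdE; have [j0 qj0] := Hn_exponent.
have [gen gy gY sx sX] := DP; have [_ _ univ] := gen.
have lamn := lam_expn lamE.
have pn : p ^+ n = 1 by rewrite exprVn qn invr1.
have [rho [rhoy rhoY rhox rhoX]] :=
  univ _ _ (double_rel_mx zetan qt_prim qj0 lamE t_le_n lamn cdE).
pose actD h a := mx_act vec unvec (rho h) a.
have bactD : bilinear_for *:%R *:%R actD.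
  split=> v e a b /=; rewrite /actD ?linearP /=.
    exact: (mx_act_bilinear basis).1.
  exact: (mx_act_bilinear basis).2.
have actD1 a : actD 1 a = a by rewrite /actD rmorph1 (mx_act1 basis).
have actDM g h a : actD (g * h) a = actD g (actD h a).
  by rewrite /actD rmorphM (mx_actM basis).
have yu i : actD y (u ^+ i) = zeta ^+ i *: u ^+ i.
  by rewrite /actD rhoy (mx_act_cyc basis) ?addn0 // => j; rewrite expr_mod.
have Yu i : actD Y (u ^+ i) = lam ^+ i *: u ^+ i.
  by rewrite /actD rhoY (mx_act_cyc basis) ?addn0 // => j; rewrite expr_mod.
have xu i : actD x (u ^+ i) = (c * (q ^+ i - 1)) *: u ^+ (i + t).
  by rewrite /actD rhox (mx_act_cyc basis) // => j; rewrite expr_mod.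
have Xu i : actD X (u ^+ i) = (d * (p ^+ i - 1)) *: u ^+ (i + (n - t)).
  by rewrite /actD rhoX (mx_act_cyc basis) // => j; rewrite expr_mod.
have ymu := act_expr_basis m bactD actD1 actDM yu.
have lamt : lam ^+ t = p by apply: (mulIf q0); rewrite lamE mulVf.
have Ytu := act_expr_basis t bactD actD1 actDM Yu.
have one_u i : actD 1 (u ^+ i) = 1 ^+ i *: u ^+ i.
  by rewrite actD1 expr1n scale1r.
exists actD; split=> //; split.
  apply: (module_algebra_gen bactD gen actD1 actDM) => g;
    rewrite !inE => /or4P[]/eqP->.
  - exact: (leibniz_grouplike basis bactD gy yu).
  - exact: (leibniz_grouplike basis bactD gY Yu).
  - apply: (leibniz_skew basis bactD sx ymu one_u xu) => i j.
    by rewrite exprD expr1n; ring.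
  - apply: (leibniz_skew basis bactD sX one_u Ytu Xu) => i j.
    by rewrite exprD expr1n lamt; ring.
  - by rewrite counit_grouplike // -(expr0 u) yu.
  - by rewrite counit_grouplike // -(expr0 u) Yu.
  - rewrite (counit_skew1r (grouplikeX m gy) sx) -(expr0 u) xu.
    by rewrite expr0 subrr mulr0 !scale0r.
  - rewrite (counit_skew1l (grouplikeX t gY) sX) -(expr0 u) Xu.
    by rewrite expr0 subrr mulr0 !scale0r.
have [genH _ _] := HnP; have [bact act1 actM _ _] := modA.
move=> h; move: h; apply: (presented_ind genH).
- by move=> a; rewrite rmorph1 actD1 act1.
- move=> e g h eg eh a; rewrite linearP (bactD.1 a e (iota g) (iota h)).
  by rewrite (bact.1 a e g h) /= eg eh.
- by move=> g h eg eh a; rewrite rmorphM actDM eh eg actM.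
- move=> g; rewrite !inE => /orP[]/eqP->.
    rewrite iota_y; apply: (basis_ext basis (bactD.2 y) (bact.2 yH)) => i.
    by rewrite yu actyu.
  rewrite iota_x; apply: (basis_ext basis (bactD.2 x) (bact.2 xH)) => i.
  by rewrite xu actxu.
Qed.

Lemma ext_formulas actD : extensions iota act actD -> exists lam d,
  [/\ lam ^+ t * q = 1, q ^+ 2 != 1 -> c * d * (p ^+ t - 1) = 1,
    forall i, actD Y (u ^+ i) = lam ^+ i *: u ^+ i &
    forall i, actD X (u ^+ i) = (d * (p ^+ i - 1)) *: u ^+ (i + (n - t))].
Proof.
move=> [modD extD]; have [gen gy gY sx sX] := DP.
have [[[yn Yn] _ [yx YX] [yY xY yX] xX] _ _] := gen.
have [bactD actD1 actDM _ _] := modD.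
have yu i : actD y (u ^+ i) = zeta ^+ i *: u ^+ i by rewrite -iota_y extD.
have xu i : actD x (u ^+ i) = (c * (q ^+ i - 1)) *: u ^+ (i + t).
  by rewrite -iota_x extD.
have yu1 : actD y u = zeta *: u by have := yu 1%N; rewrite expr1.
have xu1 : actD x u = (c * (q - 1)) *: u ^+ (1 + t).
  by have := xu 1%N; rewrite expr1.
pose lam := coef vec 1 (actD Y u).
(* [Y] commutes with [y], hence preserves the weight of [u]. *)
have Yu1 : actD Y u = lam *: u.
  rewrite -[u in RHS]expr1.
  apply: (weight_space basis zeta_prim (bactD.2 y) yu).
  by rewrite -actDM yY actDM yu1 (lfun_Z (bactD.2 Y)).
have Yu := act_grouplike_basis modD gY Yu1.
have lamn : lam ^+ n = 1.
  apply: (basis_scaleI basis (i := 1)).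
  have := act_expr_basis n bactD actD1 actDM Yu 1.
  by rewrite Yn actD1 expr1 => <-; rewrite scale1r.
have lam0 : lam != 0.
  by apply: contra_eq_neq lamn => ->; rewrite expr0n eq_sym oner_eq0.
have q1 : q - 1 != 0 by rewrite subr_eq0.
have lamE : lam ^+ t * q = 1.
  have := congr1 (fun h => actD h u) xY; rewrite /= actDM Yu1.
  rewrite (lfun_Z (bactD.2 x)) (lfun_Z (bactD.1 u)) actDM xu1.
  rewrite (lfun_Z (bactD.2 Y)) Yu !scalerA => /(basis_scaleI basis) E.
  apply: (mulfI (mulf_neq0 lam0 (mulf_neq0 c_neq0 q1))).
  by rewrite mulr1 [RHS]E exprD expr1; ring.
have lamt : lam ^+ t = p by apply: (mulIf q0); rewrite lamE mulVf.
have p1 : p - 1 != 0 by rewrite subr_eq0 invr_eq1.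
(* The relation [yX] puts [actD X u] in weight [1 - t]. The divisor [p - 1] fits the skew recursion
   with 1 on the left and [Y ^+ t], acting on [u] by [p], on the right. *)
pose d := coef vec (1 + (n - t)) (actD X u) / (p - 1).
have Xu1 : actD X u = (d * (p ^+ 1 - 1)) *: u ^+ (1 + (n - t)).
  rewrite expr1 divfK //; apply: (weight_space basis zeta_prim (bactD.2 y) yu).
  rewrite -actDM yX (lfun_Z (bactD.1 u)) actDM yu1 (lfun_Z (bactD.2 X)) scalerA.
  congr (_ *: _); apply: (mulIf (expf_neq0 t zeta0)).
  rewrite mulrAC mulVf ?expf_neq0 // mul1r -exprD -addnA subnK //.
  by rewrite exprD zetan mulr1 expr1.
have Xu i : actD X (u ^+ i) = (d * (p ^+ i - 1)) *: u ^+ (i + (n - t)).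
  move: i; apply: (act_skew_basis modD (z := 1) (w := p)
                     (f := fun i => d * (p ^+ i - 1)) sX).
  - exact: (counit_skew1l (grouplikeX t gY) sX).
  - by move=> i; rewrite actD1 expr1n scale1r.
  - have := act_expr_basis t bactD actD1 actDM Yu 1.
    by rewrite !expr1 lamt.
  - exact: Xu1.
  - by rewrite expr0 subrr mulr0.
  - by move=> i; rewrite exprSr expr1 expr1n; ring.
exists lam, d; split=> // q2.
(* Evaluation at [u] alone suffices: it gives (q - p)(c d (p^t - 1) - 1) = 0, and [q - p] is nonzero
   because [q ^+ 2 != 1]. *)
have := congr1 (fun h => actD h u) xX.
rewrite /= !(lfun_B (bactD.1 u)) !actDM Xu1 xu1.
rewrite (lfun_Z (bactD.2 x)) (lfun_Z (bactD.2 X)) xu Xu !scalerA.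
have uB : u ^+ (1 + (n - t) + t) = u ^+ 1.
  by apply: (basis_expmod basis); rewrite -addnA subnK // modnDr.
rewrite (addnAC 1 t) uB -scalerBl.
have -> : actD (Y ^+ t) u = p *: u ^+ 1.
  have := act_expr_basis t bactD actD1 actDM Yu 1.
  by rewrite !expr1 lamt.
have -> : actD (y ^+ m) u = q *: u ^+ 1.
  have := act_expr_basis m bactD actD1 actDM yu 1.
  by rewrite !expr1.
rewrite -scalerBl => /(basis_scaleI basis).
have -> : q ^+ (1 + (n - t)) = q * p ^+ t.
  apply: (mulIf (expf_neq0 t q0)).
  rewrite -exprD -addnA subnK // exprD qn mulr1 expr1.
  by rewrite -mulrA -exprMn mulVf // expr1n mulr1.
rewrite exprD !expr1 => E.
have qp : q - p != 0.
  apply: contraNneq q2 => /eqP; rewrite subr_eq0 => /eqP e.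
  by rewrite expr2 {2}e mulfV.
apply/eqP; rewrite -subr_eq0; apply/eqP/(mulfI qp); rewrite mulr0.
by move/eqP: E; rewrite -subr_eq0 => /eqP E; rewrite -[RHS]oppr0 -E; ring.
Qed.

Lemma ext_unique act1 act2 :
  extensions iota act act1 -> extensions iota act act2 ->
  (forall i, act1 Y (u ^+ i) = act2 Y (u ^+ i)) ->
  (forall i, act1 X (u ^+ i) = act2 X (u ^+ i)) -> act1 = act2.
Proof.
move=> [mod1 ext1] [mod2 ext2] eqY eqX; have [gen _ _ _ _] := DP.
have [b1 _ _ _ _] := mod1; have [b2 _ _ _ _] := mod2.
apply: (module_algebra_ext gen mod1 mod2) => g; rewrite !inE.
case/or4P=> /eqP->.
- by move=> a; rewrite -iota_y ext1 ext2.
- exact: (basis_ext basis (b1.2 Y) (b2.2 Y)).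
- by move=> a; rewrite -iota_x ext1 ext2.
- exact: (basis_ext basis (b1.2 X) (b2.2 X)).
Qed.

End Extensions.

(** * Existence of A(H) *)

Section HnNormalForm.
Variables (k : fieldType) (n m t N : nat) (zeta : k).
Hypotheses (zeta_neq0 : zeta != 0) (N_gt0 : (0 < N)%N).
Variables (H : hopfAlgebra k) (y x : H).
Hypothesis HnP : is_Hn n m t N zeta y x.

Lemma Hn_normal_form h : exists P : nat -> {poly k},
  h = \sum_(j < N) horner_alg y (P j) * x ^+ j.
Proof.
have [gen _ _] := HnP; have [[_ xN yx] _ _] := gen.
pose W h := exists P : nat -> {poly k},
  h = \sum_(j < N) horner_alg y (P j) * x ^+ j.
have W1 : W 1.
  exists (fun j => if j == 0%N then 1 else 0).
  rewrite -(prednK N_gt0) big_ord_recl big1 /= ?addr0.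
    by rewrite rmorph1 mulr1.
  by move=> j _; rewrite rmorph0 mul0r.
have WL c g g' : W g -> W g' -> W (c *: g + g').
  move=> [P ->] [P' ->]; exists (fun j => c *: P j + P' j).
  rewrite scaler_sumr -big_split; apply: eq_bigr => j _ /=.
  by rewrite linearP /= mulr_algl mulrDl scalerAl.
have xy j : x ^+ j * y = (zeta ^- t) ^+ j *: (y * x ^+ j).
  have xy1 : x * y = zeta ^- t *: (y * x).
    by rewrite yx scalerA mulVf ?expf_neq0 // scale1r.
  elim: j => [|j IH]; first by rewrite !expr0 mul1r mulr1 scale1r.
  rewrite [in LHS]exprS -mulrA IH -scalerAr [x * (y * _)]mulrA xy1 -scalerAl.
  by rewrite scalerA -exprSr -mulrA -exprS.
(* Stability of [W] under products is not directly visible, so the induction is on right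
   multiplication: [y] moves to the left past [x ^+ j] at the cost of a scalar, and [x] raises [j],
   the top term dying by [x ^+ N = 0]. *)
suff WM : forall g, W g -> W (g * h) by rewrite -[h]mul1r; apply: WM.
move: h; apply: (presented_ind gen).
- by move=> g; rewrite mulr1.
- move=> c h h' IHh IHh' g Wg; rewrite mulrDr -scalerAr.
  by apply: WL; [apply: IHh | apply: IHh'].
- by move=> h h' IHh IHh' g Wg; rewrite mulrA; apply/IHh'/IHh.
move=> h; rewrite !inE => /orP[]/eqP-> g [P ->].
  exists (fun j => (zeta ^- t) ^+ j *: (P j * 'X)).
  rewrite mulr_suml; apply: eq_bigr => j _.
  rewrite -mulrA xy -scalerAr linearZ /= mulr_algl rmorphM /= horner_algX.
  by rewrite -scalerAl mulrA.
exists (fun j => if j is j'.+1 then P j' else 0).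
rewrite -(prednK N_gt0) mulr_suml big_ord_recr big_ord_recl /=.
rewrite rmorph0 mul0r add0r -[X in _ + X]mulrA -exprSr prednK // xN mulr0 addr0.
by apply: eq_bigr => j _; rewrite -mulrA -exprSr.
Qed.

End HnNormalForm.

Section HnExistence.
Variables (k : fieldType) (n' m t N j0 : nat) (zeta : k).
Local Notation n := n'.+1.
Local Notation q := (zeta ^+ m).
Hypotheses (zeta_prim : n.-primitive_root zeta).
Hypotheses (qt_prim : N.-primitive_root (q ^+ t)).
Hypothesis qj0 : q ^+ (1 + j0 * t) = 1.
Variables (H : hopfAlgebra k) (y x : H).
Hypothesis HnP : is_Hn n m t N zeta y x.
Variables (A : algType k) (u : A).
Variables (vec : A -> 'cV[k]_n) (unvec : 'cV[k]_n -> A).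
Hypothesis basis : cyclic_basis u vec unvec.

Let zetan : zeta ^+ n = 1. Proof. exact: prim_expr_order zeta_prim. Qed.
Let qn : q ^+ n = 1. Proof. by rewrite -exprM mulnC exprM zetan expr1n. Qed.
Let zeta0 : zeta != 0.
Proof. by apply: contra_eq_neq zetan => ->; rewrite expr0n eq_sym oner_eq0. Qed.
Let N_gt0 : (0 < N)%N. Proof. exact: prim_order_gt0 qt_prim. Qed.

Lemma Hn_module_algebra : exists act : H -> A -> A,
  [/\ module_algebra act,
      forall i, act y (u ^+ i) = zeta ^+ i *: u ^+ i &
      forall i, act x (u ^+ i) = (q ^+ i - 1) *: u ^+ (i + t)].
Proof.
have [gen gy sx] := HnP; have [_ _ univ] := gen.
have [rho [rhoy rhox]] := univ _ _ (Hn_rel_mx zetan qt_prim qj0 1).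
pose act h a := mx_act vec unvec (rho h) a.
have bact : bilinear_for *:%R *:%R act.
  split=> v e a b /=; rewrite /act ?linearP /=.
    exact: (mx_act_bilinear basis).1.
  exact: (mx_act_bilinear basis).2.
have act1 a : act 1 a = a by rewrite /act rmorph1 (mx_act1 basis).
have actM g h a : act (g * h) a = act g (act h a).
  by rewrite /act rmorphM (mx_actM basis).
have yu i : act y (u ^+ i) = zeta ^+ i *: u ^+ i.
  by rewrite /act rhoy (mx_act_cyc basis) ?addn0 // => j; rewrite expr_mod.
have xu i : act x (u ^+ i) = (q ^+ i - 1) *: u ^+ (i + t).
  rewrite /act rhox (mx_act_cyc basis) ?mul1r // => j.
  by rewrite expr_mod.
have ymu := act_expr_basis m bact act1 actM yu.
have one_u i : act 1 (u ^+ i) = 1 ^+ i *: u ^+ i.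
  by rewrite act1 expr1n scale1r.
exists act; split=> //.
apply: (module_algebra_gen bact gen act1 actM) => g;
  rewrite !inE => /orP[]/eqP->.
- exact: (leibniz_grouplike basis bact gy yu).
- apply: (leibniz_skew basis bact sx ymu one_u xu) => i j.
  by rewrite exprD expr1n; ring.
- by rewrite counit_grouplike // -(expr0 u) yu.
- rewrite (counit_skew1r (grouplikeX m gy) sx) -(expr0 u) xu.
  by rewrite expr0 subrr !scale0r.
Qed.

(** * Faithfulness on the tensor square *)

Variable act : H -> A -> A.
Hypothesis modA : module_algebra act.
Hypothesis yu : forall i, act y (u ^+ i) = zeta ^+ i *: u ^+ i.
Hypothesis xu : forall i, act x (u ^+ i) = (q ^+ i - 1) *: u ^+ (i + t).

Let bact : bilinear_for *:%R *:%R act. Proof. by case: modA. Qed.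
Let act1 a : act 1 a = a. Proof. by case: modA. Qed.
Let actM g h a : act (g * h) a = act g (act h a). Proof. by case: modA. Qed.
Let ymu := act_expr_basis m bact act1 actM yu.

Let coefZ b c a : coef vec b (c *: a) = c * coef vec b a.
Proof. exact: (lfun_Z (coef_linear basis b)). Qed.

(* The action of [h] on [a (x) a'] in [A (x) A], followed by the [b]-th
   coordinate on the second factor. *)
Let tens b a a' h : A :=
  \sum_(p <- comul h) coef vec b (act p.2 a') *: act p.1 a.

Let tens_bilinear b a a' : bilinear_for *:%R *:%R
  (fun g h => coef vec b (act h a') *: act g a).
Proof.
split=> v e g h /=.
  by rewrite (bact.1 a e g h) scalerDr !scalerA mulrC.
rewrite (bact.1 a' e g h) (coef_linear basis) scalerDl.
by rewrite scalerA.
Qed.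

Let tensM b a a' g h : tens b a a' (g * h) =
  \sum_(p <- comul g) \sum_(r <- comul h)
    coef vec b (act p.2 (act r.2 a')) *: act p.1 (act r.1 a).
Proof.
rewrite /tens (sum_comulM (tens_bilinear b a a')).
by apply: eq_bigr => p _; apply: eq_bigr => r _; rewrite !actM.
Qed.

Let tens_arg_bilinear b (p : H * H) a a' : bilinear_for *:%R *:%R
  (fun g h => coef vec b (act p.2 (act h a')) *: act p.1 (act g a)).
Proof.
split=> v e g h /=.
  rewrite (bact.1 a e g h) (bact.2 p.1) scalerDr !scalerA mulrC.
  by [].
rewrite (bact.1 a' e g h) (bact.2 p.2) (coef_linear basis) scalerDl.
by rewrite scalerA.
Qed.

Let tens_y b i j g : tens b (u ^+ i) (u ^+ j) (g * y) =
  zeta ^+ (i + j) *: tens b (u ^+ i) (u ^+ j) g.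
Proof.
have [_ gy _] := HnP; rewrite tensM scaler_sumr; apply: eq_bigr => p _.
rewrite (sum_comul_grouplike (tens_arg_bilinear b p _ _) gy) !yu.
rewrite !(lfun_Z (bact.2 _)) coefZ.
by rewrite !scalerA exprD; congr (_ *: _); ring.
Qed.

Let tens_x b i j g : tens b (u ^+ i) (u ^+ j) (g * x) =
  (q ^+ i * (q ^+ j - 1)) *: tens b (u ^+ i) (u ^+ (j + t)) g +
  (q ^+ i - 1) *: tens b (u ^+ (i + t)) (u ^+ j) g.
Proof.
have [_ _ sx] := HnP; rewrite tensM !scaler_sumr -big_split.
apply: eq_bigr => p _ /=.
rewrite (sum_comul_skew (tens_arg_bilinear b p _ _) sx) ymu !xu act1.
rewrite !(lfun_Z (bact.2 _)) coefZ.
by rewrite !scalerA mulrAC [X in _ + X *: _]mulrC [(q ^+ j - 1) * _]mulrC.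
Qed.

Let tens_poly b i j P : tens b (u ^+ i) (u ^+ j) (horner_alg y P) =
  (P.[zeta ^+ (i + j)] * (b == j %[mod n])%:R) *: u ^+ i.
Proof.
have lt : linear (tens b (u ^+ i) (u ^+ j)).
  by move=> e g h; rewrite /tens (sum_comulP (tens_bilinear b _ _)).
elim/poly_ind: P => [|P e IH].
  by rewrite rmorph0 (lfun_0 lt) horner0 mul0r scale0r.
rewrite rmorphD rmorphM /= horner_algX horner_algC (lfun_D lt) (lfun_Z lt).
rewrite tens_y IH hornerMXaddC scalerA.
rewrite /tens (sum_comul1 (tens_bilinear b _ _)) !act1 (coef_basis basis) scalerA.
by rewrite -scalerDl; congr (_ *: _); ring.
Qed.

(** The second factor starts [s] steps of [t] above [u ^+ b], and [x ^+ l] raises it by at most [l]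
    further steps. A positive number of steps below [N] never returns to [u ^+ b], because [q ^+ t]
    has order [N]. *)
Let tens_poly_x0 b P s : (0 < s)%N -> forall l i, (l + s < N)%N ->
  tens b (u ^+ i) (u ^+ (b + s * t)) (horner_alg y P * x ^+ l) = 0.
Proof.
move=> s_gt0 l; elim: l s s_gt0 => [|l IH] s s_gt0 i lt_N.
  rewrite expr0 mulr1 tens_poly; case: eqP => [eq_b|_]; last first.
    by rewrite mulr0 scale0r.
  have /dvdnP[e es] : (n %| s * t)%N.
    by rewrite /dvdn -(mod0n n) -(eqn_modDl b) addn0 eq_b.
  have : (q ^+ t) ^+ s == 1.
    by rewrite -exprM mulnC es mulnC exprM qn expr1n.
  by rewrite -(prim_order_dvd qt_prim) gtnNdvd.
rewrite exprSr mulrA tens_x -addnA -mulSnr !IH ?scaler0 ?addr0 //.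
  by apply: leq_trans lt_N; rewrite addSn.
by apply: leq_trans lt_N; rewrite addSn addnS.
Qed.

(** The coordinate at the starting exponent [b] retains only the term in which every [x] hits the
    first factor. The second factor then merely shifts the weight seen by [P]; on [A] alone this
    weight and the product would depend on the same [i]. *)
Let tens_poly_x b P l i : (l < N)%N ->
  tens b (u ^+ i) (u ^+ b) (horner_alg y P * x ^+ l) =
  (P.[zeta ^+ (i + l * t + b)] * \prod_(e < l) (q ^+ (i + e * t) - 1)) *:
    u ^+ (i + l * t).
Proof.
elim: l i => [|l IH] i lt_N.
  by rewrite expr0 mulr1 tens_poly big_ord0 eqxx mul0n addn0.
rewrite exprSr mulrA tens_x IH; last exact: ltnW.
have := tens_poly_x0 b P (isT : (0 < 1)%N) (l := l) i.
rewrite mul1n addn1 => -> //; rewrite scaler0 add0r scalerA big_ord_recl.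
rewrite mul0n addn0 mulSn addnA; congr (_ *: _).
rewrite mulrCA; congr (_ * (_ * _)).
by apply: eq_bigr => e _; rewrite /= mulSn addnA.
Qed.

(* A Hopf ideal that annihilates [A] also annihilates [A (x) A], on which the
   action of [H] is faithful. *)
Lemma Hn_inner_faithful : inner_faithful act.
Proof.
move=> I [I0 Iid Icomul _ _] [h hI h0]; apply: contrapT => nact.
have actI g a : g \in I -> act g a = 0.
  move=> gI; apply/eqP/negPn/negP => ga; apply: nact.
  by exists g => //; exists a.
have tensI b a a' g : g \in I -> tens b a a' g = 0.
  move=> gI; have [s eqs sI] := Icomul g gI.
  rewrite /tens (eqs _ _ (tens_bilinear b a a')) big_seq big1 // => p /sI.
  case=> pI; first by rewrite (actI _ a pI) scaler0.
  by rewrite (actI _ a' pI) (lfun_0 (coef_linear basis b)) scale0r.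
have [gen _ _] := HnP; have [[yn xN _] _ _] := gen.
have [P eh] := Hn_normal_form zeta0 N_gt0 HnP h.
have exj : exists j, (j < N)%N && (horner_alg y (P j) != 0).
  apply: contrapT => nexj; case/eqP: h0; rewrite eh big1 // => j _.
  have [->|Pj0] := eqVneq (horner_alg y (P j)) 0; first by rewrite mul0r.
  by case: nexj; exists j; rewrite ltn_ord.
case: (ex_minnP exj) => j /andP[lt_jN Pj] minj; case/eqP: Pj.
(* The complementary power of [x] isolates the lowest term: those below [j] vanish by minimality,
   those above acquire a factor [x ^+ N]. *)
have xI : horner_alg y (P j) * x ^+ N.-1 \in I.
  have /Iid -/(_ (x ^+ (N.-1 - j)))[_] := hI.
  rewrite eh mulr_suml (bigD1 (Ordinal lt_jN)) //= big1 ?addr0.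
    by rewrite -mulrA -exprD subnKC // -ltnS prednK.
  move=> i /negPf ne_ij; have [lt_ij|lt_ji|eq_ij] := ltngtP i j.
  - have [->|Pi] := eqVneq (horner_alg y (P i)) 0; first by rewrite !mul0r.
    by have := minj i; rewrite ltn_ord Pi leqNgt lt_ij => /(_ isT).
  - rewrite -mulrA -exprD.
    have -> : (i + (N.-1 - j) = N + (i - j).-1)%N.
      by have := ltn_ord i; lia.
    by rewrite exprD xN mul0r mulr0.
  - by rewrite -val_eqE /= eq_ij eqxx in ne_ij.
(* Starting the first factor at [u ^+ t] makes the product one of [(q ^+ t) ^+ e.+1 - 1] with
   [e.+1 < N], all nonzero. In the second exponent the multiple of [n'] acts as a subtraction modulo
   [n], chosen so that [P j] is evaluated at [zeta ^+ i]. *)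
have roots i : (P j).[zeta ^+ i] = 0.
  have := tensI (i + n' * (t + N.-1 * t))%N (u ^+ t)
    (u ^+ (i + n' * (t + N.-1 * t))) _ xI.
  rewrite tens_poly_x ?ltn_predL // => /eqP.
  rewrite scaler_eq0 (negPf (basis_neq0 basis _)) orbF mulf_eq0.
  have -> : (t + N.-1 * t + (i + n' * (t + N.-1 * t)) =
             n * (t + N.-1 * t) + i)%N by ring.
  rewrite exprD exprM zetan expr1n mul1r => /orP[/eqP-> //|].
  move=> /prodf_eq0[e _]; rewrite -mulSn mulnC exprM subr_eq0.
  rewrite -(prim_order_dvd qt_prim) gtnNdvd // -[X in (_ < X)%N](prednK N_gt0).
  by rewrite ltnS.
have : 'X^n - 1 %| P j.
  rewrite -(factor_Xn_sub_1 zeta_prim) big_mkord.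
  rewrite -(big_map (fun i : 'I_n => zeta ^+ i) xpredT (fun z => 'X - z%:P)).
  apply: uniq_roots_dvdp.
    by apply/allP => z /mapP[i _ ->]; rewrite /root roots.
  rewrite uniq_rootsE map_inj_uniq ?index_enum_uniq // => i1 i2 /eqP.
  rewrite (eq_prim_root_expr zeta_prim) !modn_small // => /eqP.
  exact: val_inj.
case/dvdpP => Q ->; rewrite rmorphM rmorphB rmorph1 rmorphXn /= horner_algX.
by rewrite yn subrr mulr0.
Qed.

End HnExistence.

Lemma Hn_is_AH_exists (k : fieldType) (n' m t N j0 : nat) (zeta : k)
    (H : hopfAlgebra k) (y x : H) :
  n'.+1.-primitive_root zeta -> N.-primitive_root ((zeta ^+ m) ^+ t) ->
  (zeta ^+ m) ^+ (1 + j0 * t) = 1 -> is_Hn n'.+1 m t N zeta y x ->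
  exists (A : algType k) (act : H -> A -> A), is_AH n'.+1 zeta y act.
Proof.
move=> zeta_prim qt_prim qj0 HnP.
pose A : algType k := {poly %/ ('X^(n'.+1) - 1 : {poly k})}.
have bij_id : bijective (idfun : A -> A) by exists idfun.
have [vec [unvec basis]] :=
  @qpoly_cyclic_basis k n' A (idfun : {lrmorphism A -> A}) bij_id.
have [act [modA yu xu]] :=
  Hn_module_algebra zeta_prim qt_prim qj0 HnP basis.
exists A, act; split=> //.
  exact: (Hn_inner_faithful zeta_prim qt_prim HnP basis modA yu xu).
exists (idfun : {lrmorphism A -> A}); split=> //.
by have := yu 1%N; rewrite !expr1.
Qed.

(** * Counting extensions *)

(** Since [t %| m], the element [zeta ^- (m / t)] is one solution; the others are its multiples by
    [t]-th roots of unity, which are powers of [zeta] because [t %| n]. *)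
Lemma root_seq (k : fieldType) (n m t : nat) (zeta : k) :
  n.-primitive_root zeta -> (t %| n)%N -> (t %| m)%N ->
  exists s : seq k, [/\ uniq s, size s = t &
    forall z, (z \in s) = (z ^+ t * zeta ^+ m == 1)].
Proof.
move=> zeta_prim t_dvd_n /dvdnP[m' em].
have om_prim := dvdn_prim_root zeta_prim t_dvd_n.
set om := zeta ^+ _ in om_prim; pose z0 := zeta ^- m'.
have zeta0 : zeta != 0.
  by rewrite (prim_root_eq0 zeta_prim) -lt0n (prim_order_gt0 zeta_prim).
have z00 : z0 != 0 by rewrite invr_eq0 expf_neq0.
have z0E : z0 ^+ t * zeta ^+ m = 1.
  by rewrite exprVn -exprM -em mulVf // expf_neq0.
exists [seq z0 * om ^+ (i : 'I_t) | i <- enum 'I_t]; split.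
- rewrite map_inj_uniq ?enum_uniq // => i j /(mulfI z00)/eqP.
  by rewrite (eq_prim_root_expr om_prim) !modn_small // => /eqP/val_inj.
- by rewrite size_map size_enum_ord.
move=> z; apply/mapP/eqP => [[i _ ->]|ez].
  by rewrite exprMn mulrAC z0E mul1r exprAC (prim_expr_order om_prim) expr1n.
have [|i ei] := prim_rootP om_prim (x := z / z0).
  apply: (mulIf (mulf_neq0 (expf_neq0 t z00) (expf_neq0 m zeta0))).
  by rewrite mulrA -exprMn divfK // ez z0E mulr1.
by exists i; rewrite ?mem_enum // -ei mulrC divfK.
Qed.

Lemma card_eq_seq (T : Type) (K : eqType) (S : set T) (s : seq K) (f : T -> K) :
  uniq s -> (forall x, S x -> f x \in s) ->
  (forall x y, S x -> S y -> f x = f y -> x = y) ->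
  (forall z, z \in s -> exists2 x, S x & f x = z) ->
  (S #= `I_(size s))%card.
Proof.
move=> us fS finj fsurj; apply/card_set_bijP.
exists (fun x => index (f x) s); split.
- by move=> x /fS; rewrite -index_mem.
- move=> x y /set_mem Sx /set_mem Sy eq_i; apply: finj => //.
  by rewrite -(nth_index (f x) (fS x Sx)) eq_i nth_index // fS.
- move=> i /= lt_i.
  (* [nth] needs a default; an index below [size s] guarantees an entry that can serve. *)
  have z0 : K by case: (s) lt_i => [|z ? _] //; exact: z.
  have [x Sx fx] := fsurj _ (mem_nth z0 lt_i).
  by exists x; rewrite // fx index_uniq.
Qed.

Theorem corollary4p21 (k : closedFieldType) (char0 : [pchar k] =i pred0)
  (n m t N : nat) (zeta : k)
  (n_gt0 : (0 < n)%N) (m_gt0 : (0 < m)%N) (t_gt0 : (0 < t)%N)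
  (m_dvd : (m %| n)%N) (t_dvd : (t %| n)%N) (n_ndvd : ~~ (n %| m * t)%N)
  (zeta_prim : n.-primitive_root zeta)
  (N_order : N.-primitive_root (zeta ^+ (m * t)))
  (H : hopfAlgebra k) (yH xH : H) (HnP : is_Hn n m t N zeta yH xH)
  (D : hopfAlgebra k) (y Y x X : D) (DP : is_double_Hn n m t N zeta y Y x X)
  (iota : {lrmorphism H -> D}) (iota_y : iota yH = y) (iota_x : iota xH = x) :
  [/\ (* m <> n/2 *)
      forall (A : algType k) (act : H -> A -> A), is_AH n zeta yH act ->
        (2 * m)%N <> n ->
        (extensions iota act #= `I_t)%card,
      (* m <> n/2 and t = 1 *)
      t = 1%N -> (2 * m)%N <> n ->
        (exists (A : algType k) (act : H -> A -> A), is_AH n zeta yH act) /\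
        (forall (A : algType k) (act : H -> A -> A), is_AH n zeta yH act ->
           exists! actD : D -> A -> A, extensions iota act actD),
      odd n -> (2 * m)%N <> n &
      (* m = n/2 *)
      forall (A : algType k) (act : H -> A -> A), is_AH n zeta yH act ->
        (2 * m)%N = n ->
        ([set actD Y | actD in extensions iota act] #= `I_t)%card /\
        forall Yop : A -> A,
          [set actD Y | actD in extensions iota act] Yop ->
          exists (X0 X1 : A -> A) (ext : k -> D -> A -> A),
            [/\ exists a, X1 a != 0,
                set_bij [set: k]
                  [set actD | extensions iota act actD /\ actD Y = Yop] ext &
                forall c a, ext c X a = X0 a + c *: X1 a]].
Proof.
case: n n_gt0 m_dvd t_dvd n_ndvd zeta_prim HnP DP => // n' _ m_dvd t_dvd n_ndvd
  zeta_prim HnP DP.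
have qt_prim : N.-primitive_root ((zeta ^+ m) ^+ t) by rewrite -exprM.
have qt_neq1 : (zeta ^+ m) ^+ t != 1.
  by rewrite -exprM -(prim_order_dvd zeta_prim).
have q_neq1 : zeta ^+ m != 1.
  by apply: contra_neq qt_neq1 => ->; rewrite expr1n.
have N_gt1 : (1 < N)%N.
  case: (N) (prim_order_gt0 qt_prim) (prim_expr_order qt_prim) => [|[|N']] //.
  by rewrite expr1 => _ /eqP; rewrite (negPf qt_neq1).
set q := zeta ^+ m in qt_prim qt_neq1 q_neq1.
have zeta0 : zeta != 0 by rewrite (prim_root_eq0 zeta_prim).
have q0 : q != 0 by rewrite expf_neq0.
have pt_neq1 : q^-1 ^+ t - 1 != 0 by rewrite subr_eq0 exprVn invr_eq1.
(* As [n] does not divide [m * t], the quotient [n / m] exceeds 1; then [n %| 2 * m] leaves only the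
   quotient 2. *)
have q2P : q ^+ 2 == 1 <-> (2 * m)%N = n'.+1.
  rewrite -exprM -(prim_order_dvd zeta_prim) mulnC.
  have [d ed] := dvdnP m_dvd.
  have d_gt1 : (1 < d)%N.
    case: d ed => [|[|d]] //; rewrite mul1n => em.
    by rewrite em dvdn_mulr in n_ndvd.
  split=> [|->]; last exact: dvdnn.
  by rewrite ed dvdn_pmul2r // => /(dvdn_leq (ltn0Sn 1)) le_d2; congr (_ * _)%N; lia.
(* An extension thus amounts to a pair of [lam] in [s] and an admissible [d]; all the counts below
   are read off from this. *)
have AHP (A : algType k) act : is_AH n'.+1 zeta yH act ->
    exists (u : A) vec unvec c (s : seq k),
    [/\ @cyclic_basis k n' A u vec unvec, c != 0,
        [/\ uniq s, size s = t & forall z, (z \in s) = (z ^+ t * q == 1)],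
        forall lam d, lam \in s ->
          (q ^+ 2 != 1 -> c * d * (q^-1 ^+ t - 1) = 1) ->
          exists actD, [/\ extensions iota act actD,
            forall i, actD Y (u ^+ i) = lam ^+ i *: u ^+ i &
            forall i, actD X (u ^+ i) =
              (d * (q^-1 ^+ i - 1)) *: u ^+ (i + (n'.+1 - t))] &
        forall actD, extensions iota act actD -> exists lam d,
          [/\ lam \in s, q ^+ 2 != 1 -> c * d * (q^-1 ^+ t - 1) = 1,
            forall i, actD Y (u ^+ i) = lam ^+ i *: u ^+ i &
            forall i, actD X (u ^+ i) =
              (d * (q^-1 ^+ i - 1)) *: u ^+ (i + (n'.+1 - t))]].
  move=> AH; have modA : module_algebra act by case: AH.
  have [u [vec [unvec [c [basis c0 yu xu]]]]] :=
    Hn_action zeta_prim q_neq1 N_gt1 HnP AH.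
  have tm := dvd_t_m zeta_prim t_dvd HnP modA basis c0 xu.
  have [s sP] := root_seq zeta_prim t_dvd tm.
  exists u, vec, unvec, c, s; split=> // [lam d lam_s dE|actD ext].
    apply: (ext_exists zeta_prim qt_prim t_dvd HnP DP iota_y iota_x
              modA basis c0 yu xu _ dE).
    by apply/eqP; case: sP => _ _ <-.
  have [lam [d [lamE dE Yu Xu]]] :=
    ext_formulas zeta_prim q_neq1 t_dvd DP iota_y iota_x basis c0 yu xu ext.
  exists lam, d; split=> //.
  by case: sP => _ _ ->; apply/eqP.
have uniqP (A : algType k) act u vec unvec c :
    @cyclic_basis k n' A u vec unvec -> c != 0 -> (2 * m)%N <> n'.+1 ->
    forall act1 act2 lam d1 d2,
    extensions iota act act1 -> extensions iota act act2 ->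
    (q ^+ 2 != 1 -> c * d1 * (q^-1 ^+ t - 1) = 1) ->
    (q ^+ 2 != 1 -> c * d2 * (q^-1 ^+ t - 1) = 1) ->
    (forall i, act1 Y (u ^+ i) = lam ^+ i *: u ^+ i) ->
    (forall i, act2 Y (u ^+ i) = lam ^+ i *: u ^+ i) ->
    (forall i, act1 X (u ^+ i) =
      (d1 * (q^-1 ^+ i - 1)) *: u ^+ (i + (n'.+1 - t))) ->
    (forall i, act2 X (u ^+ i) =
      (d2 * (q^-1 ^+ i - 1)) *: u ^+ (i + (n'.+1 - t))) -> act1 = act2.
  move=> basis c0 m2 act1 act2 lam d1 d2 ext1 ext2 dE1 dE2 Y1 Y2 X1 X2.
  have q2 : q ^+ 2 != 1 by apply/negP => /q2P.
  have ed : d1 = d2.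
    apply: (mulfI c0); apply: (mulIf pt_neq1).
    by rewrite dE1 // dE2.
  apply: (ext_unique DP iota_y iota_x basis ext1 ext2) => i.
    by rewrite Y1 Y2.
  by rewrite X1 X2 ed.
have coefY (A : algType k) u vec unvec (f : A -> A) lam :
    @cyclic_basis k n' A u vec unvec ->
    (forall i, f (u ^+ i) = lam ^+ i *: u ^+ i) -> coef vec 1 (f u) = lam.
  move=> basis fu; have := fu 1%N; rewrite !expr1 => ->.
  rewrite (lfun_Z (coef_linear basis 1)) -[u]expr1 (coef_basis basis) eqxx.
  exact: mulr1.
(* The value of [d] forced by the constraint outside the case [q ^+ 2 = 1]. *)
have exd c : c != 0 -> c * (c * (q^-1 ^+ t - 1))^-1 * (q^-1 ^+ t - 1) = 1.
  by move=> c0; rewrite invfM mulrA mulfV // mul1r mulVf.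
split.
- move=> A act AH m2.
  have [u [vec [unvec [c [s [basis c0 [us ss _] exP invP]]]]]] := AHP A act AH.
  rewrite -ss; apply: (card_eq_seq (f := fun actD => coef vec 1 (actD Y u)) us).
  + by move=> actD /invP[lam [d [lam_s _ Yu _]]]; rewrite (coefY _ _ _ _ _ _ basis Yu).
  + move=> act1 act2 ext1 ext2.
    have [lam1 [d1 [_ dE1 Y1 X1]]] := invP _ ext1.
    have [lam2 [d2 [_ dE2 Y2 X2]]] := invP _ ext2.
    rewrite (coefY _ _ _ _ _ _ basis Y1) (coefY _ _ _ _ _ _ basis Y2) => e.
    rewrite -e in Y2.
    exact: (uniqP _ _ _ _ _ _ basis c0 m2 _ _ _ _ _ ext1 ext2 dE1 dE2 Y1 Y2 X1 X2).
  + move=> lam lam_s; have [actD [ext Yu _]] := exP lam _ lam_s (fun=> exd c c0).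
    by exists actD; rewrite // (coefY _ _ _ _ _ _ basis Yu).
- move=> t1 m2; split.
    (* For [t = 1] the exponent equation holds with [j0 = N - 1], as [q] itself has order [N]; no
       given action is needed to obtain it. *)
    apply: (@Hn_is_AH_exists _ _ _ _ _ N.-1 _ _ _ _ zeta_prim qt_prim _ HnP).
    rewrite t1 muln1 add1n prednK ?(ltnW N_gt1) //.
    by move: (prim_expr_order qt_prim); rewrite t1 expr1.
  move=> A act AH.
  have [u [vec [unvec [c [s [basis c0 [us ss _] exP invP]]]]]] := AHP A act AH.
  move: ss us; rewrite t1; case: s exP invP => [|lam [|//]] // exP invP _ _.
  have [actD [ext Yu Xu]] := exP lam _ (mem_head _ _) (fun=> exd c c0).
  exists actD; split=> // act2 ext2.
  have [lam2 [d2 [lam_s dE2 Y2 X2]]] := invP _ ext2.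
  move: lam_s; rewrite inE => /eqP e; rewrite e in Y2.
  exact: (uniqP _ _ _ _ _ _ basis c0 m2 _ _ _ _ _ ext ext2 (fun=> exd c c0) dE2
            Yu Y2 Xu X2).
- by move=> odd_n m2; rewrite -m2 mul2n odd_double in odd_n.
move=> A act AH m2; have q2 := q2P.2 m2.
have [u [vec [unvec [c [s [basis c0 [us ss _] exP invP]]]]]] := AHP A act AH.
have qE d : q ^+ 2 != 1 -> c * d * (q^-1 ^+ t - 1) = 1 by rewrite q2.
have Y_ext act1 act2 lam : extensions iota act act1 -> extensions iota act act2 ->
    (forall i, act1 Y (u ^+ i) = lam ^+ i *: u ^+ i) ->
    (forall i, act2 Y (u ^+ i) = lam ^+ i *: u ^+ i) -> act1 Y = act2 Y.
  move=> [[b1 _ _ _ _] _] [[b2 _ _ _ _] _] Y1 Y2; apply/funext.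
  by apply: (basis_ext basis (b1.2 Y) (b2.2 Y)) => i; rewrite Y1 Y2.
split.
  rewrite -ss; apply: (card_eq_seq (f := fun Yop => coef vec 1 (Yop u)) us).
  - move=> _ [actD /invP[lam [d [lam_s _ Yu _]]] <-].
    by rewrite (coefY _ _ _ _ _ _ basis Yu).
  - move=> _ _ [act1 ext1 <-] [act2 ext2 <-].
    have [lam1 [d1 [_ _ Y1 _]]] := invP _ ext1.
    have [lam2 [d2 [_ _ Y2 _]]] := invP _ ext2.
    rewrite (coefY _ _ _ _ _ _ basis Y1) (coefY _ _ _ _ _ _ basis Y2) => e.
    by rewrite -e in Y2; apply: (Y_ext _ _ _ ext1 ext2 Y1 Y2).
  - move=> lam lam_s; have [actD [ext Yu _]] := exP lam 0 lam_s (qE 0).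
    by exists (actD Y); [exists actD | rewrite (coefY _ _ _ _ _ _ basis Yu)].
move=> _ [act0 ext0 <-].
have [lam [_ [lam_s _ Y0 _]]] := invP _ ext0.
have [ext extP] := choice (fun d => exP lam d lam_s (qE d)).
pose X1 := mx_act vec unvec
  (cyc_mx n' (fun i => q^-1 ^+ i - 1) (n'.+1 - t)).
have qn : q ^+ n'.+1 = 1.
  by rewrite -exprM mulnC exprM (prim_expr_order zeta_prim) expr1n.
have X1u i : X1 (u ^+ i) = (q^-1 ^+ i - 1) *: u ^+ (i + (n'.+1 - t)).
  rewrite /X1 (mx_act_cyc basis) // => j.
  by rewrite expr_mod // exprVn qn invr1.
have X1l : linear X1 := (mx_act_bilinear basis).2 _.
have p1 : q^-1 - 1 != 0 by rewrite subr_eq0 invr_eq1.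
have extX d a : ext d X a = d *: X1 a.
  have [[[bd _ _ _ _] _] _ Xd] := extP d.
  apply: (basis_ext basis (bd.2 X) (g := fun a => d *: X1 a)).
    by move=> e a1 a2; rewrite X1l scalerDr !scalerA mulrC.
  by move=> i; rewrite Xd X1u scalerA.
have X1u1 : X1 u != 0.
  rewrite -[u]expr1 X1u scaler_eq0 expr1 (negPf p1).
  exact: (basis_neq0 basis).
(* By [extX] the possible operators for [X] form the line spanned by [X1], so the base point [X0]
   can be the zero map. *)
exists (fun=> 0), X1, ext; split.
- by exists u.
- split.
  + move=> d _; have [extd Yd _] := extP d; split=> //.
    exact: (Y_ext _ _ _ extd ext0 Yd Y0).
  + move=> d1 d2 _ _ e; have := extX d1 u; rewrite e extX => /eqP.
    rewrite -subr_eq0 -scalerBl scaler_eq0 (negPf X1u1) orbF subr_eq0.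
    by move/eqP.
  + move=> actD [extD YD]; have [lam2 [d [_ _ Y2 X2]]] := invP _ extD.
    exists d => //; have [extd Yd Xd] := extP d.
    apply: (ext_unique DP iota_y iota_x basis extd extD) => i.
      by rewrite YD Yd Y0.
    by rewrite Xd X2.
- by move=> d a; rewrite add0r extX.
Qed.
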